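(* Let $k\in\{2,3,4\}$. Every $\mathrm{Sp}(2)\mathrm{Sp}(1)$-orbit in $\mathrm{Gr}_k$ contains a $k$-plane of the form $$\mathrm{span}_{\mathbb R}\{(\cos\theta_1,\sin\theta_1),(\cos\theta_2,\sin\theta_2)\mathbf i\}\quad (k=2),$$ $$\mathrm{span}_{\mathbb R}\{(\cos\theta_1,\sin\theta_1),(\cos\theta_2,\sin\theta_2)\mathbf i,(\cos\theta_3,\sin\theta_3)\mathbf j\}\quad (k=3),$$ $$\mathrm{span}_{\mathbb R}\{(\cos\theta_1,\sin\theta_1),(\cos\theta_2,\sin\theta_2)\mathbf i,(\cos\theta_3,\sin\theta_3)\mathbf j,(\cos\theta_4,\sin\theta_4)\mathbf k\}\quad (k=4),$$ where $\theta_1,\dots,\theta_4\in[0,2\pi]$. The class $[\lambda]\in X_k$ corresponding to the orbit is given by $\lambda_{pq}=\cos(\theta_p-\theta_q)$, $1\le p<q\le k$.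
   Context: $\mathbb H$ denotes the quaternions; $\mathbb H^2$ is a right $\mathbb H$-vector space with quaternionic hermitian product $K(v,w)=\bar v_1w_1+\bar v_2w_2$. $\mathrm{Sp}(2)\mathrm{Sp}(1)$ is the group of transformations of $\mathbb H^2\cong\mathbb R^8$ generated by left multiplication by $\mathrm{Sp}(2)$ (quaternionic $2\times 2$ matrices with $A^*A=\mathrm{Id}$) and right multiplication by unit quaternions. $\mathrm{Gr}_k$ is the Grassmann manifold of real $k$-dimensional subspaces of $\mathbb H^2$. For a real tuple $\lambda=(\lambda_{pq})_{1\le p<q\le k}$, $M_\lambda$ is the hyperhermitian $k\times k$ matrix with diagonal entries $1$ and entries above the diagonal: $(1,2)$: $\lambda_{12}\mathbf i$; $(1,3)$: $\lambda_{13}\mathbf j$; $(2,3)$: $-\lambda_{23}\mathbf k$; $(1,4)$: $\lambda_{14}\mathbf k$; $(2,4)$: $\lambda_{24}\mathbf j$; $(3,4)$: $-\lambda_{34}\mathbf i$ (using those entries with indices $\le k$). The Moore rank of a hyperhermitian matrix is the quaternionic dimension of its image. $X_k$ is the quotient of $\{\lambda_{pq}\in[-1,1]:\text{Moore rank of }M_\lambda\le2\}$ by the equivalence relation generated by $\lambda_{pq}\mapsto\epsilon_p\epsilon_q\lambda_{pq}$ ($\epsilon\in\{\pm1\}^k$) and $\lambda_{pq}\mapsto\lambda_{\sigma(p)\sigma(q)}$ ($\sigma\in\mathcal S_k$, with $\lambda_{qp}:=\lambda_{pq}$). The correspondence between $X_k$ and $\mathrm{Gr}_k/\mathrm{Sp}(2)\mathrm{Sp}(1)$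 is the homeomorphism under which $[\lambda]$ corresponds to the orbit containing a plane with a basis $v_1,\dots,v_k$ such that $K(v_i,v_j)=(M_\lambda)_{i,j}$ for all $i,j$. *)

(* Defs.v *)
(* Built on MathComp and MathComp-Analysis. *)
From HB Require Import structures.
From Stdlib Require Import Relation_Operators.
From mathcomp Require Import all_boot all_order all_algebra all_fingroup.
From mathcomp Require Import generic_quotient.
From mathcomp Require Import all_classical all_reals all_analysis.
From mathcomp Require Import ring.

Set Implicit Arguments.
Unset Strict Implicit.
Unset Printing Implicit Defensive.

Import Order.TTheory GRing.Theory Num.Theory.

Local Open Scope classical_set_scope.
Local Open Scope ring_scope.

(* Hamilton's quaternions: Quat a b c d stands for a + b i + c j + d k. *)
Record quat (R : Type) := Quat { q0 : R; q1 : R; q2 : R; q3 : R }.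

Section Quaternions.
Variable R : realType.
Local Notation H := (quat R).
Implicit Types x y z : H.

Lemma quat_ext x y :
  q0 x = q0 y -> q1 x = q1 y -> q2 x = q2 y -> q3 x = q3 y -> x = y.
Proof. by case: x y => [? ? ? ?] [? ? ? ?] /= -> -> -> ->. Qed.

Definition quat_to_prod x := (q0 x, q1 x, q2 x, q3 x).
Definition quat_of_prod (t : R * R * R * R) :=
  let: (a, b, c, d) := t in Quat a b c d.
Lemma quat_to_prodK : cancel quat_to_prod quat_of_prod.
Proof. by case. Qed.

HB.instance Definition _ := Choice.copy H (can_type quat_to_prodK).

Definition quat_zero : H := Quat 0 0 0 0.
Definition quat_opp x := Quat (- q0 x) (- q1 x) (- q2 x) (- q3 x).
Definition quat_add x y :=
  Quat (q0 x + q0 y) (q1 x + q1 y) (q2 x + q2 y) (q3 x + q3 y).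

Lemma quat_addA : associative quat_add.
Proof. by move=> x y z; apply: quat_ext => /=; rewrite addrA. Qed.
Lemma quat_addC : commutative quat_add.
Proof. by move=> x y; apply: quat_ext => /=; rewrite addrC. Qed.
Lemma quat_add0 : left_id quat_zero quat_add.
Proof. by move=> x; apply: quat_ext => /=; rewrite add0r. Qed.
Lemma quat_addN : left_inverse quat_zero quat_opp quat_add.
Proof. by move=> x; apply: quat_ext => /=; rewrite addNr. Qed.

HB.instance Definition _ :=
  GRing.isZmodule.Build H quat_addA quat_addC quat_add0 quat_addN.

Definition quat_one : H := Quat 1 0 0 0.
Definition quat_mul x y :=
  Quat (q0 x * q0 y - q1 x * q1 y - q2 x * q2 y - q3 x * q3 y)
       (q0 x * q1 y + q1 x * q0 y + q2 x * q3 y - q3 x * q2 y)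
       (q0 x * q2 y - q1 x * q3 y + q2 x * q0 y + q3 x * q1 y)
       (q0 x * q3 y + q1 x * q2 y - q2 x * q1 y + q3 x * q0 y).

Lemma quat_mulA : associative quat_mul.
Proof. by move=> x y z; apply: quat_ext => /=; ring. Qed.
Lemma quat_mul1x : left_id quat_one quat_mul.
Proof. by move=> x; apply: quat_ext => /=; ring. Qed.
Lemma quat_mulx1 : right_id quat_one quat_mul.
Proof. by move=> x; apply: quat_ext => /=; ring. Qed.
Lemma quat_mulDl : left_distributive quat_mul +%R.
Proof. by move=> x y z; apply: quat_ext => /=; ring. Qed.
Lemma quat_mulDr : right_distributive quat_mul +%R.
Proof. by move=> x y z; apply: quat_ext => /=; ring. Qed.
Lemma quat_one_neq0 : quat_one != 0.
Proof. by apply/eqP => -[]; apply/eqP; rewrite oner_neq0. Qed.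

HB.instance Definition _ := GRing.Zmodule_isNzRing.Build H
  quat_mulA quat_mul1x quat_mulx1 quat_mulDl quat_mulDr quat_one_neq0.

Definition quat_scale (a : R) x :=
  Quat (a * q0 x) (a * q1 x) (a * q2 x) (a * q3 x).

Lemma quat_scaleA a b x :
  quat_scale a (quat_scale b x) = quat_scale (a * b) x.
Proof. by apply: quat_ext => /=; rewrite mulrA. Qed.
Lemma quat_scale1 : left_id 1 quat_scale.
Proof. by move=> x; apply: quat_ext => /=; rewrite mul1r. Qed.
Lemma quat_scaleDr : right_distributive quat_scale +%R.
Proof. by move=> a x y; apply: quat_ext => /=; rewrite mulrDr. Qed.
Lemma quat_scaleDl x : {morph quat_scale^~ x : a b / a + b}.
Proof. by move=> a b; apply: quat_ext => /=; rewrite mulrDl. Qed.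

HB.instance Definition _ := GRing.Zmodule_isLmodule.Build R H
  quat_scaleA quat_scale1 quat_scaleDr quat_scaleDl.

Lemma quat_scaleAl (a : R) x y : a *: (x * y) = (a *: x) * y.
Proof. by apply: quat_ext => /=; ring. Qed.
HB.instance Definition _ := GRing.Lmodule_isLalgebra.Build R H quat_scaleAl.
Lemma quat_scaleAr (a : R) x y : a *: (x * y) = x * (a *: y).
Proof. by apply: quat_ext => /=; ring. Qed.
HB.instance Definition _ := GRing.Lalgebra_isAlgebra.Build R H quat_scaleAr.

Fact quat_vect_axiom : Vector.axiom 4 H.
Proof.
exists (fun x => \row_(i < 4) [:: q0 x; q1 x; q2 x; q3 x]`_i).
  move=> a x y; apply/rowP => i; rewrite !mxE.
  by case: i => -[|[|[|[|]]]].
exists (fun v : 'rV[R]_4 => Quat (v 0 (inord 0)) (v 0 (inord 1))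
                                 (v 0 (inord 2)) (v 0 (inord 3))).
  by move=> x; apply: quat_ext; rewrite /= mxE inordK.
move=> v; apply/rowP => i; rewrite mxE.
by case: i => -[|[|[|[|]]]] //= lti; congr (v _ _); apply/val_inj;
  rewrite /= inordK.
Qed.
HB.instance Definition _ := Lmodule_hasFinDim.Build R H quat_vect_axiom.

Definition qi : H := Quat 0 1 0 0.
Definition qj : H := Quat 0 0 1 0.
Definition qk : H := Quat 0 0 0 1.

Definition qconj x : H := Quat (q0 x) (- q1 x) (- q2 x) (- q3 x).
Definition qnormsq x : R := q0 x ^+ 2 + q1 x ^+ 2 + q2 x ^+ 2 + q3 x ^+ 2.

End Quaternions.

Arguments qi {R}.
Arguments qj {R}.
Arguments qk {R}.

(* H^2 is used as an 8-dimensional real vector space. *)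
Notation quat2 R := (quat R * quat R)%type.

Section Grassmannian.
Variable R : realType.
Local Notation H := (quat R).

Definition hprod (v w : quat2 R) : H :=
  qconj v.1 * w.1 + qconj v.2 * w.2.

Definition lmult (A : 'M[H]_2) (v : quat2 R) : quat2 R :=
  (A ord0 ord0 * v.1 + A ord0 ord_max * v.2,
   A ord_max ord0 * v.1 + A ord_max ord_max * v.2).
Definition rmult (q : H) (v : quat2 R) : quat2 R := (v.1 * q, v.2 * q).

Fact lmult_linear A : linear (lmult A).
Proof.
move=> a u v; congr pair; rewrite /= !mulrDr !scalerDr !scalerAr;
  by rewrite addrACA.
Qed.
HB.instance Definition _ A :=
  GRing.isLinear.Build R (quat2 R) (quat2 R) _ (lmult A) (lmult_linear A).

Fact rmult_linear q : linear (rmult q).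
Proof. by move=> a u v; congr pair; rewrite /= !mulrDl -!scalerAl. Qed.
HB.instance Definition _ q :=
  GRing.isLinear.Build R (quat2 R) (quat2 R) _ (rmult q) (rmult_linear q).

Definition Sp2 : set 'M[H]_2 :=
  [set A | (map_mx (@qconj R) A)^T *m A = 1%:M].
Definition Sp1 : set H := [set q | qnormsq q = 1].

Inductive Sp2Sp1 : 'End(quat2 R) -> Prop :=
| Sp2Sp1_left A : Sp2 A -> Sp2Sp1 (linfun (lmult A))
| Sp2Sp1_right q : Sp1 q -> Sp2Sp1 (linfun (rmult q))
| Sp2Sp1_id : Sp2Sp1 \1%VF
| Sp2Sp1_comp f g : Sp2Sp1 f -> Sp2Sp1 g -> Sp2Sp1 (f \o g)%VF
| Sp2Sp1_inv f : Sp2Sp1 f -> Sp2Sp1 (f^-1)%VF.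

Definition Gr (k : nat) := {U : {vspace quat2 R} | \dim U == k}.

Definition orbit_of k (P : Gr k) : set (Gr k) :=
  [set Q | exists2 g, Sp2Sp1 g & (g @: val P)%VS = val Q].
Definition is_orbit k (O : set (Gr k)) := exists P, O = orbit_of P.

End Grassmannian.

Section ParameterSpace.
Variables (R : realType) (k : nat).
Local Notation H := (quat R).

(* Indices are shifted by one: p : 'I_k is the index p + 1 of 1, ..., k. *)
Definition param := {ffun {pq : 'I_k * 'I_k | (pq.1 < pq.2)%N} -> R}.

(* lam_pq, extended symmetrically (and by the junk value 0 when p = q). *)
Definition coef (lam : param) (p q : 'I_k) : R :=
  if insub (p, q) is Some e then lam e
  else if insub (q, p) is Some e then lam e else 0.

Definition upper_unit (p q : nat) : H :=
  match p, q with
  | 0%N, 1%N => qi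
  | 0%N, 2%N => qj
  | 1%N, 2%N => - qk
  | 0%N, 3%N => qk
  | 1%N, 3%N => qj
  | 2%N, 3%N => - qi
  | _, _ => 0 (* not reached when p < q < k <= 4 *)
  end.

Definition Mmx (lam : param) : 'M[H]_k :=
  \matrix_(p < k, q < k)
    if (p < q)%N then coef lam p q *: upper_unit p q
    else if (q < p)%N then qconj (coef lam q p *: upper_unit q p)
    else 1.

(* The columns of B form a basis of the image of M, as a right H-vector
   space: B *m c is the combination of these columns with the coefficients c
   on the right. *)
Definition moore_rank (M : 'M[H]_k) (r : nat) : Prop :=
  exists B : 'M[H]_(k, r),
    (forall c : 'cV[H]_r, B *m c = 0 -> c = 0) /\
    [set M *m x | x in [set: 'cV[H]_k]] = [set B *m c | c in [set: 'cV[H]_r]].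

Definition admissible (lam : param) : Prop :=
  (forall e, -1 <= lam e <= 1) /\
  (exists2 r, (r <= 2)%N & moore_rank (Mmx lam) r).

Definition adm := {lam : param | `[< admissible lam >]}.

Definition adm_step (lam mu : adm) : Prop :=
  (exists eps : 'I_k -> bool, forall p q : 'I_k, (p < q)%N ->
     coef (val mu) p q =
     (-1) ^+ eps p * (-1) ^+ eps q * coef (val lam) p q) \/
  (exists s : 'S_k, forall p q : 'I_k, (p < q)%N ->
     coef (val mu) p q = coef (val lam) (s p) (s q)).

Definition adm_rel (lam mu : adm) : bool :=
  `[< clos_refl_sym_trans adm adm_step lam mu >].

Fact adm_rel_refl : reflexive adm_rel.
Proof. by move=> x; apply/asboolP; exact: rst_refl. Qed.
Fact adm_rel_sym : symmetric adm_rel.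
Proof.
by move=> x y; apply/idP/idP => /asboolP h; apply/asboolP; exact: rst_sym.
Qed.
Fact adm_rel_trans : transitive adm_rel.
Proof.
by move=> y x z /asboolP h1 /asboolP h2; apply/asboolP; exact: rst_trans h1 h2.
Qed.
Canonical adm_equiv := EquivRel adm_rel adm_rel_refl adm_rel_sym adm_rel_trans.

Definition X := {eq_quot adm_equiv}%qT.

Definition class_of (lam : adm) : X := (\pi_X lam)%qT.

(* The graph of the bijection between X_k and the orbit space. *)
Definition corresponds (x : X) (O : set (Gr R k)) : Prop :=
  exists2 lam : adm, x = class_of lam &
  exists2 P : Gr R k, O P &
  exists2 v : k.-tuple (quat2 R), basis_of (val P) v &
  forall i j, hprod (tnth v i) (tnth v j) = Mmx (val lam) i j.

End ParameterSpace.

Section NormalForm.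
Variables (R : realType) (k : nat).

Definition unit_of (p : nat) : quat R :=
  match p with 0%N => 1 | 1%N => qi | 2%N => qj | _ => qk end.

Definition theta_vec (theta : 'I_k -> R) (p : 'I_k) : quat2 R :=
  rmult (unit_of p) ((cos (theta p))%:A, (sin (theta p))%:A).

Definition theta_span (theta : 'I_k -> R) : {vspace quat2 R} :=
  <<[seq theta_vec theta p | p : 'I_k]>>%VS.

End NormalForm.

(* Main.v *)
Require Import Defs.
From Stdlib Require Import Relation_Operators.
From mathcomp Require Import all_boot all_order all_algebra all_fingroup.
From mathcomp Require Import all_classical all_reals all_analysis.
From mathcomp Require Import ring lra.

Set Implicit Arguments.
Unset Strict Implicit.
Unset Printing Implicit Defensive.

Import Order.TTheory GRing.Theory Num.Theory.
Import numFieldNormedType.Exports.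

Local Open Scope ring_scope.

(** Why the theorem is true.

    Normal form of 2-planes and 3-planes.  In an orthonormal basis v of the
    plane the products K(v_p, v_q) are imaginary for p <> q.  For a 3-plane
    they form three vectors of R^3, that is, a 3 x 3 matrix, on which a change
    of basis and a right factor in Sp(1) act by rotations of the two sides; a
    singular value decomposition ([rotation_svd]) puts the products along
    i, j, k.  An element of Sp(2) moves v_1 to (1, 0), after which the first
    coordinates are real multiples of the right units and a last left factor on
    the second coordinate finishes ([align_second]).

    Normal form of 4-planes.  Choose the quaternionic line for which the
    projection of the plane has the largest determinant.  That determinant is
    not zero ([exists_proj_unit]), so that the plane is the graph of a
    real-linear map Z of H, and the vanishing of the first variation says that
    x |-> h Z(x) is traceless for every h ([critical_graph_trace]).  Therefore
    Z(x) is a sum of terms z_b x b over b = i, j, k only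
    ([traceless_sandwich]).  The symmetries x |-> p' Z(p^-1 x q^-1) q act on the
    triple (z_b), a 4 x 3 real matrix, by rotations of both sides, and so it
    can be brought to z_b = t_b b.  Then Z is diagonal in the basis
    1, i, j, k, and its graph is spanned by real multiples of the units
    ([normalizable4]).  The determinant is maximised, rather than some other
    function of the projection, because its critical points control Z itself,
    even when the singular values coincide.

    The parameter.  The vectors of the normal form have M_lambda as Gram matrix
    for lambda_pq = cos(theta_p - theta_q) ([Mmx_cos_param]), and M_lambda
    factors through H^2, which bounds its rank ([admissible_cos_param]).

    Uniqueness of the class.  If frames with Gram matrices M_lambda and M_mu span
    planes of one orbit, then the coordinates of M_mu on i, j, k, which are three
    skew real matrices, are obtained from those of M_lambda by a congruence by an
    orthogonal matrix and a rotation of the triple ([gram_relation]).  On such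
    triples the forms tr(X Y) and, for k = 4, the Pfaffian are invariant, up to an
    orientation sign for the latter.  Both triples are orthogonal for both forms,
    so any nonzero term of the determinant of the rotation matches the three
    units in a way that preserves the values of the two forms
    ([orthogonal_rotation]).  The alternating trilinear forms tr(X Y Z) and
    Pf(X, [Y, Z]) supply the missing signs ([alternating_rotation]).  What
    remains is elementary: for k = 4, writing x_c and y_c for the parameters of
    the pair {0, c} and of the complementary pair, the squares and the products
    of the three x_c + y_c and of the three x_c - y_c are known, and the signed
    permutations realise exactly the remaining ambiguity ([sim4]). *)

(** * Quaternion arithmetic *)

Section QuaternionArithmetic.
Variable R : realType.
Local Notation H := (quat R).
Implicit Types (x y z : H) (a : R).

Lemma qconjM x y : qconj (x * y) = qconj y * qconj x.
Proof. by apply: quat_ext => /=; ring. Qed.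

Lemma qconjD x y : qconj (x + y) = qconj x + qconj y.
Proof. by apply: quat_ext => /=; ring. Qed.

Lemma qconjZ a x : qconj (a *: x) = a *: qconj x.
Proof. by apply: quat_ext => /=; ring. Qed.

Lemma qconjK : involutive (@qconj R).
Proof. by move=> x; apply: quat_ext => /=; ring. Qed.

Lemma qconj_mul x : qconj x * x = (qnormsq x)%:A.
Proof. by rewrite /qnormsq; apply: quat_ext => /=; ring. Qed.

Lemma mul_qconj x : x * qconj x = (qnormsq x)%:A.
Proof. by rewrite /qnormsq; apply: quat_ext => /=; ring. Qed.

Lemma qnormsqM x y : qnormsq (x * y) = qnormsq x * qnormsq y.
Proof. by rewrite /qnormsq /=; ring. Qed.

Lemma qnormsq_conj x : qnormsq (qconj x) = qnormsq x.
Proof. by rewrite /qnormsq /=; ring. Qed.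

Lemma qnormsqZ a x : qnormsq (a *: x) = a ^+ 2 * qnormsq x.
Proof. by rewrite /qnormsq /=; ring. Qed.

Lemma qnormsq_ge0 x : 0 <= qnormsq x.
Proof. by rewrite !addr_ge0 ?sqr_ge0. Qed.

Lemma qnormsq_eq0 x : (qnormsq x == 0) = (x == 0).
Proof.
apply/idP/eqP => [|->]; last by rewrite /qnormsq /= expr0n !addr0.
rewrite !paddr_eq0 ?addr_ge0 ?sqr_ge0 // !sqrf_eq0 => /andP[/andP[/andP[]]].
by do 4![move=> /eqP ?]; apply: quat_ext.
Qed.

Lemma qnormsq_gt0 x : x != 0 -> 0 < qnormsq x.
Proof. by move=> x0; rewrite lt_neqAle qnormsq_ge0 eq_sym qnormsq_eq0 x0. Qed.

Lemma qnormsq1 : qnormsq (1 : H) = 1.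
Proof. by rewrite /qnormsq /=; ring. Qed.

Definition qunit x : H := (Num.sqrt (qnormsq x))^-1 *: x.

Lemma qnormsq_unit x : x != 0 -> qnormsq (qunit x) = 1.
Proof.
move=> x0; have nx := qnormsq_gt0 x0.
by rewrite qnormsqZ exprVn sqr_sqrtr ?ltW // mulVf // gt_eqF.
Qed.

Definition qinv x : H := (qnormsq x)^-1 *: qconj x.

Lemma qinvV x : x != 0 -> qinv x * x = 1.
Proof.
move=> x0; rewrite -scalerAl qconj_mul scalerA mulVf ?scale1r //.
by rewrite qnormsq_eq0.
Qed.

Lemma qmulf_eq0 x y : x * y = 0 -> x != 0 -> y = 0.
Proof.
by move=> xy0 /qinvV vx; rewrite -[y]mul1r -vx -mulrA xy0 mulr0.
Qed.

(** The rotation [x |-> q x q^*] of the imaginary quaternions, as a matrix in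
    the basis i, j, k; it is not normalised, so that its entries are polynomial
    in [q] and it is defined without assuming that [q] is a unit. *)
Definition qrot (q : H) : 'M[R]_3 := \matrix_(a, b)
  nth 0 (nth [::] [::
    [:: q0 q ^+ 2 + q1 q ^+ 2 - q2 q ^+ 2 - q3 q ^+ 2;
        2 * (q1 q * q2 q - q0 q * q3 q); 2 * (q1 q * q3 q + q0 q * q2 q)];
    [:: 2 * (q1 q * q2 q + q0 q * q3 q);
        q0 q ^+ 2 - q1 q ^+ 2 + q2 q ^+ 2 - q3 q ^+ 2;
        2 * (q2 q * q3 q - q0 q * q1 q)];
    [:: 2 * (q1 q * q3 q - q0 q * q2 q); 2 * (q2 q * q3 q + q0 q * q1 q);
        q0 q ^+ 2 - q1 q ^+ 2 - q2 q ^+ 2 + q3 q ^+ 2]] a) b.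

Definition qim x (b : 'I_3) : R := nth 0 [:: q1 x; q2 x; q3 x] b.

End QuaternionArithmetic.

(** * Singular values of a real 3 x 3 matrix, by rotations *)

Section Maximum.
Variable R : realType.
Implicit Types (n : nat).

Lemma max_on_bounded_closed n (A : set 'rV[R]_n) (f : 'rV[R]_n -> R) :
  (A !=set0)%classic -> closed A ->
  (forall v, A v -> forall i, `|v ord0 i| <= 1) ->
  continuous f -> exists2 c, A c & forall v, A v -> f v <= f c.
Proof.
move=> A0 Acl Abd fc.
have cK : compact [set v : 'rV[R]_n | forall i, `[(-1), 1]%classic (v ord0 i)].
  by apply: (@rV_compact R n (fun=> `[(-1), 1]%classic)) => i; exact: segment_compact.
have cA : compact A.
  apply: (subclosed_compact Acl cK) => v Av i /=.
  by rewrite in_itv /= -ler_norml Abd.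
have [|c cA' cmax] := @EVT_max_rV R n f A A0 cA.
  exact: continuous_subspaceT.
exists c; first by rewrite inE in cA'.
by move=> v Av; apply: cmax; rewrite inE.
Qed.

(** Continuity of functions of a row vector, as a constant of its own so that
    simplification does not unfold it into neighbourhoods. *)
Record rvcts n (f : 'rV[R]_n -> R) : Prop := RvCts { rvctsP : continuous f }.

Lemma cts_coord n (i : 'I_n) : rvcts (fun v : 'rV[R]_n => v ord0 i).
Proof. by split; exact: coord_continuous. Qed.

Lemma cts_cst n (a : R) : rvcts (fun _ : 'rV[R]_n => a).
Proof. by split; exact: cst_continuous. Qed.

Lemma ctsD n (f g : 'rV[R]_n -> R) : rvcts f -> rvcts g ->
  rvcts (fun v => f v + g v).
Proof. by move=> [fc] [gc]; split=> v; exact: (cvgD (fc v) (gc v)). Qed.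

Lemma ctsN n (f : 'rV[R]_n -> R) : rvcts f -> rvcts (fun v => - f v).
Proof. by move=> [fc]; split=> v; exact: (cvgN (fc v)). Qed.

Lemma ctsM n (f g : 'rV[R]_n -> R) : rvcts f -> rvcts g ->
  rvcts (fun v => f v * g v).
Proof. by move=> [fc] [gc]; split=> v; exact: (cvgM (fc v) (gc v)). Qed.

Lemma cts_sum n (I : Type) (r : seq I) (f : I -> 'rV[R]_n -> R) :
  (forall i, rvcts (f i)) -> rvcts (fun v => \sum_(i <- r) f i v).
Proof.
move=> fc; elim: r => [|i r IHr].
  have -> : (fun v => \sum_(i <- [::]) f i v) = fun=> 0 by apply/funext => v; rewrite big_nil.
  exact: cts_cst.
have -> : (fun v => \sum_(j <- i :: r) f j v) = fun v => f i v + \sum_(j <- r) f j v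
  by apply/funext => v; rewrite big_cons.
exact: ctsD.
Qed.

Lemma cts_prod n (I : Type) (r : seq I) (f : I -> 'rV[R]_n -> R) :
  (forall i, rvcts (f i)) -> rvcts (fun v => \prod_(i <- r) f i v).
Proof.
move=> fc; elim: r => [|i r IHr].
  have -> : (fun v => \prod_(i <- [::]) f i v) = fun=> 1 by apply/funext => v; rewrite big_nil.
  exact: cts_cst.
have -> : (fun v => \prod_(j <- i :: r) f j v) = fun v => f i v * \prod_(j <- r) f j v
  by apply/funext => v; rewrite big_cons.
exact: ctsM.
Qed.

Lemma cts_det n m (A : 'rV[R]_n -> 'M[R]_m) :
  (forall i j, rvcts (fun v => A v i j)) ->
  rvcts (fun v => \det (A v)).
Proof.
move=> Ac; rewrite /determinant; apply: cts_sum => s.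
by apply: ctsM; [exact: cts_cst|apply: cts_prod => i].
Qed.

End Maximum.

Ltac cts := lazymatch goal with
  | |- rvcts (fun v => @?f v + @?g v) => apply: (@ctsD _ _ f g); cts
  | |- rvcts (fun v => - (@?f v)) => apply: (@ctsN _ _ f); cts
  | |- rvcts (fun v => @?f v * @?g v) => apply: (@ctsM _ _ f g); cts
  | |- rvcts (fun v => fun_of_matrix v ord0 ?i) => exact: cts_coord
  | |- rvcts (fun v => ?c) => exact: cts_cst
  end.

Section SingularValues.
Variable R : realType.
Local Notation H := (quat R).

Definition lquat (v : 'rV[R]_8) : H := Quat (v ord0 (inord 0))
  (v ord0 (inord 1)) (v ord0 (inord 2)) (v ord0 (inord 3)).
Definition rquat (v : 'rV[R]_8) : H := Quat (v ord0 (inord 4))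
  (v ord0 (inord 5)) (v ord0 (inord 6)) (v ord0 (inord 7)).
Definition row_of_quats (x y : H) : 'rV[R]_8 :=
  \row_i [:: q0 x; q1 x; q2 x; q3 x; q0 y; q1 y; q2 y; q3 y]`_i.

Lemma lquat_row x y : lquat (row_of_quats x y) = x.
Proof. by apply: quat_ext; rewrite /= mxE inordK. Qed.

Lemma rquat_row x y : rquat (row_of_quats x y) = y.
Proof. by apply: quat_ext; rewrite /= mxE inordK. Qed.

Lemma sqr_sum_le1 (a b c d : R) : a ^+ 2 + b ^+ 2 + c ^+ 2 + d ^+ 2 <= 1 ->
  [/\ `|a| <= 1, `|b| <= 1, `|c| <= 1 & `|d| <= 1].
Proof.
have sq (x : R) : x ^+ 2 <= 1 -> `|x| <= 1.
  by move=> x1; rewrite -(@ler_pXn2r R 2) ?nnegrE // expr1n real_normK ?num_real.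
move: (sqr_ge0 a) (sqr_ge0 b) (sqr_ge0 c) (sqr_ge0 d) => ? ? ? ? ?.
by split; apply: sq; lra.
Qed.

Lemma row_coord_le1 (v : 'rV[R]_8) :
  qnormsq (lquat v) <= 1 -> qnormsq (rquat v) <= 1 ->
  forall i, `|v ord0 i| <= 1.
Proof.
move=> /sqr_sum_le1[? ? ? ?] /sqr_sum_le1[? ? ? ?].
have E k (hk : (k < 8)%N) : Ordinal hk = inord k.
  by apply/val_inj; rewrite /= inordK.
by case=> -[|[|[|[|[|[|[|[|//]]]]]]]] hk; rewrite E.
Qed.

Lemma cts_qnormsq_l : rvcts (fun v => qnormsq (lquat v)).
Proof. by rewrite /qnormsq /=; under eq_fun do rewrite !expr2; cts. Qed.

Lemma cts_qnormsq_r : rvcts (fun v => qnormsq (rquat v)).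
Proof. by rewrite /qnormsq /=; under eq_fun do rewrite !expr2; cts. Qed.

Lemma cts_mx m n p (A : 'rV[R]_8 -> 'M[R]_(m, n)) (B : 'rV[R]_8 -> 'M[R]_(n, p)) :
  (forall i j, rvcts (fun v => A v i j)) ->
  (forall i j, rvcts (fun v => B v i j)) ->
  forall i j, rvcts (fun v => (A v *m B v) i j).
Proof.
move=> Ac Bc i j; under eq_fun do rewrite mxE.
by apply: cts_sum => k; apply: ctsM.
Qed.

Lemma ord3_ind (P : 'I_3 -> Prop) :
  P ord0 -> P (inord 1) -> P (inord 2) -> forall i, P i.
Proof.
move=> P0 P1 P2 i.
have [||] : [\/ i = ord0, i = inord 1 | i = inord 2]; try by move->.
by case: i => -[|[|[|//]]] hi; [constructor 1|constructor 2|constructor 3];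
  apply/val_inj; rewrite /= ?inordK.
Qed.

Lemma cts_qrot_l a b : rvcts (fun v => qrot (lquat v) a b).
Proof.
by elim/ord3_ind: a; elim/ord3_ind: b;
  under eq_fun do rewrite mxE /= ?inordK //= ?expr2; cts.
Qed.

Lemma cts_qrot_r a b : rvcts (fun v => qrot (rquat v) a b).
Proof.
by elim/ord3_ind: a; elim/ord3_ind: b;
  under eq_fun do rewrite mxE /= ?inordK //= ?expr2; cts.
Qed.

Lemma closed_level n (f : 'rV[R]_n -> R) (c : R) : rvcts f ->
  closed [set v | f v = c]%classic.
Proof.
move=> [fc]; apply: (@preimage_closed _ _ f [set c]%classic) => [v _|]; first exact: fc.
exact: closed_eq.
Qed.

(** A linear functional whose maximum over all rotations p T q can only be
    reached at a diagonal matrix, because its weights are distinct and positive. *)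
Definition wtrace (M : 'M[R]_3) : R := \sum_(a < 3) (3 - a)%:R * M a a.

Lemma exists_max_wtrace (T : 'M[R]_3) : exists p q,
  [/\ qnormsq p = 1, qnormsq q = 1 &
   forall p' q', qnormsq p' = 1 -> qnormsq q' = 1 ->
     wtrace (qrot p' *m T *m qrot q') <= wtrace (qrot p *m T *m qrot q)].
Proof.
pose A := ([set v | qnormsq (lquat v) = 1] `&` [set v | qnormsq (rquat v) = 1])%classic.
have [||||v [Av1 Av2] vmax] := @max_on_bounded_closed R 8 A
    (fun v => wtrace (qrot (lquat v) *m T *m qrot (rquat v))).
- by exists (row_of_quats 1 1); split; rewrite /= ?lquat_row ?rquat_row qnormsq1.
- by apply: closedI; apply: closed_level; [exact: cts_qnormsq_l|exact: cts_qnormsq_r].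
- by move=> v [/= l1 r1]; apply: row_coord_le1; rewrite ?l1 ?r1.
- apply: rvctsP; apply: cts_sum => a; apply: ctsM; first exact: cts_cst.
  apply: cts_mx => [i j|i j]; last exact: cts_qrot_r.
  by apply: cts_mx => [{}i {}j|{}i {}j]; [exact: cts_qrot_l|exact: cts_cst].
exists (lquat v), (rquat v); split => // p' q' p'1 q'1.
have := vmax (row_of_quats p' q').
by rewrite lquat_row rquat_row; apply; split; rewrite /= ?lquat_row ?rquat_row.
Qed.

Lemma qrotM x y : qrot (x * y) = qrot x *m qrot y :> 'M[R]_3.
Proof.
apply/matrixP => a b; rewrite !mxE !big_ord_recl big_ord0 !mxE.
by elim/ord3_ind: a; elim/ord3_ind: b; rewrite /= ?inordK //=; ring.
Qed.

Lemma qrotZ a x : qrot (a *: x) = a ^+ 2 *: qrot x :> 'M[R]_3.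
Proof.
apply/matrixP => i j; rewrite !mxE.
by elim/ord3_ind: i; elim/ord3_ind: j; rewrite /= ?inordK //=; ring.
Qed.

Lemma qrot1 : qrot 1 = 1%:M :> 'M[R]_3.
Proof.
apply/matrixP => i j; rewrite !mxE.
by elim/ord3_ind: i; elim/ord3_ind: j; rewrite -val_eqE /= ?inordK //=; ring.
Qed.

(** A linear term dominated by a quadratic one vanishes; only [`|t| <= 1] is
    assumed so that the quadratic term may bound a polynomial remainder. *)
Lemma tangent_at_0 (a b : R) :
  (forall t, `|t| <= 1 -> t * a <= t ^+ 2 * b) -> a = 0.
Proof.
move=> h; apply/eqP/negPn/negP => a0.
pose c := `|a| + `|b| + 1; have c0 : 0 < c by rewrite ltr_wpDl ?addr_ge0.
have cb : `|b| < c by rewrite /c -addrA addrCA ltrDl ltr_wpDl.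
have ca : `|a / c| <= 1.
  by rewrite normrM normfV (gtr0_norm c0) ler_pdivrMr // mul1r /c -addrA lerDl addr_ge0.
have := h (a / c) ca; have -> : a / c * a = a ^+ 2 / c by rewrite expr2 mulrAC.
have -> : (a / c) ^+ 2 * b = a ^+ 2 / c * (b / c).
  by rewrite expr_div_n expr2; field; rewrite gt_eqF.
rewrite ler_pMr ?divr_gt0 ?exprn_even_gt0 // ler_pdivlMr // mul1r.
by apply/negP; rewrite -ltNge (le_lt_trans (ler_norm b)).
Qed.

Lemma sum3E (V : nmodType) (F : 'I_3 -> V) :
  \sum_c F c = F ord0 + F (inord 1) + F (inord 2).
Proof.
rewrite !big_ord_recr big_ord0 /= add0r.
by congr (F _ + F _ + F _); apply/val_inj; rewrite /= ?inordK.
Qed.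

Lemma wtraceE M : wtrace M =
  3 * M ord0 ord0 + 2 * M (inord 1) (inord 1) + M (inord 2) (inord 2).
Proof. by rewrite /wtrace sum3E /= !inordK // mul1r. Qed.

Lemma mulmx3E m n (A : 'M[R]_(m, 3)) (B : 'M[R]_(3, n)) i j :
  (A *m B) i j = A i ord0 * B ord0 j + A i (inord 1) * B (inord 1) j +
                 A i (inord 2) * B (inord 2) j.
Proof. by rewrite mxE sum3E. Qed.

(** At a maximum over the two rotations, the derivative in the direction of an
    infinitesimal rotation of the (a, b)-plane gives w_b M_ab = w_a M_ba on one
    side and w_a M_ab = w_b M_ba on the other; as the weights w are distinct
    and positive, M_ab = 0. *)
Lemma wtrace_max_diag (M : 'M[R]_3) :
  (forall p q, p != 0 -> q != 0 ->
     wtrace (qrot p *m M *m qrot q) <= qnormsq p * qnormsq q * wtrace M) ->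
  forall a b, a != b -> M a b = 0.
Proof.
move=> max.
have u0 (x : H) : q0 x = 1 -> x != 0.
  by move=> x1; apply/eqP => x0; move: x1; rewrite x0 /= => /eqP; rewrite eq_sym oner_eq0.
have L x : q0 x = 1 -> wtrace (qrot x *m M) <= qnormsq x * wtrace M.
  move=> /u0 x1; have := max x 1 x1 (oner_neq0 _).
  by rewrite qrot1 mulmx1 qnormsq1 mulr1.
have Rg x : q0 x = 1 -> wtrace (M *m qrot x) <= qnormsq x * wtrace M.
  move=> /u0 x1; have := max 1 x (oner_neq0 _) x1.
  by rewrite qrot1 mul1mx qnormsq1 mul1r.
have : 2 * M ord0 (inord 1) - 3 * M (inord 1) ord0 = 0.
  apply: (@tangent_at_0 _ (3 * M ord0 ord0 + 2 * M (inord 1) (inord 1))) => t _.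
  have := L (Quat 1 0 0 t) erefl.
  by rewrite !wtraceE !mulmx3E !mxE /= !inordK //= /qnormsq /=; lra.
have : 3 * M ord0 (inord 1) - 2 * M (inord 1) ord0 = 0.
  apply: (@tangent_at_0 _ (3 * M ord0 ord0 + 2 * M (inord 1) (inord 1))) => t _.
  have := Rg (Quat 1 0 0 t) erefl.
  by rewrite !wtraceE !mulmx3E !mxE /= !inordK //= /qnormsq /=; lra.
have : 3 * M (inord 2) ord0 - M ord0 (inord 2) = 0.
  apply: (@tangent_at_0 _ (3 * M ord0 ord0 + M (inord 2) (inord 2))) => t _.
  have := L (Quat 1 0 t 0) erefl.
  by rewrite !wtraceE !mulmx3E !mxE /= !inordK //= /qnormsq /=; lra.
have : M (inord 2) ord0 - 3 * M ord0 (inord 2) = 0.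
  apply: (@tangent_at_0 _ (3 * M ord0 ord0 + M (inord 2) (inord 2))) => t _.
  have := Rg (Quat 1 0 t 0) erefl.
  by rewrite !wtraceE !mulmx3E !mxE /= !inordK //= /qnormsq /=; lra.
have : M (inord 1) (inord 2) - 2 * M (inord 2) (inord 1) = 0.
  apply: (@tangent_at_0 _ (2 * M (inord 1) (inord 1) + M (inord 2) (inord 2))) => t _.
  have := L (Quat 1 t 0 0) erefl.
  by rewrite !wtraceE !mulmx3E !mxE /= !inordK //= /qnormsq /=; lra.
have : 2 * M (inord 1) (inord 2) - M (inord 2) (inord 1) = 0.
  apply: (@tangent_at_0 _ (2 * M (inord 1) (inord 1) + M (inord 2) (inord 2))) => t _.
  have := Rg (Quat 1 t 0 0) erefl.
  by rewrite !wtraceE !mulmx3E !mxE /= !inordK //= /qnormsq /=; lra.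
move=> e1 e2 e3 e4 e5 e6 a b.
elim/ord3_ind: a; elim/ord3_ind: b; rewrite ?eqxx // => _; lra.
Qed.

Lemma wtraceZ a M : wtrace (a *: M) = a * wtrace M.
Proof. by rewrite !wtraceE !mxE; ring. Qed.

(** Singular value decomposition by proper rotations, without a spectral
    theorem: a maximiser of [wtrace] does it, degenerate singular values
    included. *)
Lemma rotation_svd (T : 'M[R]_3) : exists p q,
  [/\ qnormsq p = 1, qnormsq q = 1 &
   forall a b, a != b -> (qrot p *m T *m qrot q) a b = 0].
Proof.
have [p [q [p1 q1 max]]] := exists_max_wtrace T.
exists p, q; split=> //; apply: wtrace_max_diag => x y x0 y0.
have nx := qnormsq_gt0 x0; have ny := qnormsq_gt0 y0.
(* by homogeneity, the maximum over unit quaternions bounds all quaternions *)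
have := max (qunit x * p) (q * qunit y).
rewrite !qnormsqM !qnormsq_unit // p1 q1 mulr1 => /(_ erefl erefl).
rewrite !qrotM !qrotZ !exprVn !sqr_sqrtr ?qnormsq_ge0 //.
rewrite -!scalemxAr -!scalemxAl scalerA wtraceZ !mulmxA => h.
rewrite -ler_pdivrMl ?mulr_gt0 //; apply: le_trans h.
by rewrite le_eqVlt; apply/orP; left; apply/eqP; rewrite invfM; ring.
Qed.

End SingularValues.

(** * The action of Sp(2)Sp(1) *)

Section Action.
Variable R : realType.
Local Notation H := (quat R).
Implicit Types (v w : quat2 R) (U V W : {vspace quat2 R}).

Lemma exists_angle (c s : R) : c ^+ 2 + s ^+ 2 = 1 ->
  exists2 t, 0 <= t <= 2 * pi & cos t = c /\ sin t = s.
Proof.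
move=> cs1; have c1 : -1 <= c <= 1.
  rewrite -ler_norml -(@ler_pXn2r _ 2) ?nnegrE // expr1n real_normK ?num_real //.
  by rewrite -cs1 lerDl sqr_ge0.
have a0 := acos_ge0 c1; have api := acos_lepi c1.
have ca : cos (acos c) = c by rewrite acosK // in_itv.
have sa : sin (acos c) = `|s|.
  by rewrite sin_acos // -cs1 addrAC subrr add0r sqrtr_sqr.
have [s0|s0] := lerP 0 s.
  exists (acos c); first by rewrite a0; lra.
  by rewrite ca sa ger0_norm.
exists (- acos c + pi *+ 2); first by rewrite mulr2n; lra.
by rewrite cosD2pi sinD2pi cosN sinN ca sa ltr0_norm ?opprK.
Qed.

Definition qmx2 (a b c d : H) : 'M[H]_2 := \matrix_(i, j)
  (if i == ord0 then if j == ord0 then a else b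
   else if j == ord0 then c else d).

Lemma lmult_qmx2 a b c d v :
  lmult (qmx2 a b c d) v = (a * v.1 + b * v.2, c * v.1 + d * v.2).
Proof. by rewrite /lmult !mxE. Qed.

Lemma Sp2E (A : 'M[H]_2) : Sp2 A <-> forall i j,
  qconj (A ord0 i) * A ord0 j + qconj (A ord_max i) * A ord_max j = (i == j)%:R.
Proof.
split=> [/matrixP sA i j|sA].
  have := sA i j; rewrite !mxE !big_ord_recr big_ord0 /= !mxE add0r => <-.
  by congr (qconj (A _ _) * A _ _ + _); apply/val_inj.
apply/matrixP => i j; rewrite !mxE -sA !big_ord_recr big_ord0 /= !mxE add0r.
by congr (qconj (A _ _) * A _ _ + _); apply/val_inj.
Qed.

Lemma ord2_ind (P : 'I_2 -> Prop) : P ord0 -> P ord_max -> forall i, P i.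
Proof.
by move=> P0 P1 [[|[|//]] hi]; [have -> : Ordinal hi = ord0|
  have -> : Ordinal hi = ord_max]; try apply/val_inj.
Qed.

Lemma Sp2_qmx2 a b c d : qnormsq a + qnormsq c = 1 -> qnormsq b + qnormsq d = 1 ->
  qconj a * b + qconj c * d = 0 -> Sp2 (qmx2 a b c d).
Proof.
move=> ac bd abcd; apply/Sp2E => i j.
elim/ord2_ind: i; elim/ord2_ind: j; rewrite !mxE //=.
- by rewrite !qconj_mul -scalerDl ac scale1r.
- by rewrite -[LHS]qconjK qconjD !qconjM !qconjK abcd; apply: quat_ext => /=; ring.
- by rewrite !qconj_mul -scalerDl bd scale1r.
Qed.

Lemma Sp2_diag p q : qnormsq p = 1 -> qnormsq q = 1 -> Sp2 (qmx2 p 0 0 q).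
Proof.
have n0 : qnormsq (0 : H) = 0 by apply/eqP; rewrite qnormsq_eq0.
move=> p1 q1; apply: Sp2_qmx2; rewrite ?n0 ?addr0 ?add0r //.
by rewrite mulr0 add0r; apply: quat_ext => /=; ring.
Qed.

(** Every unit row extends to an element of Sp(2): for a nonzero, the second
    row (- b^* a / |a|, |a|) has its second entry real, which makes it
    orthogonal to the first row and the two columns orthogonal as well. *)
Lemma Sp2_complete a b : qnormsq a + qnormsq b = 1 -> exists c d,
  [/\ Sp2 (qmx2 a b c d), c * qconj a + d * qconj b = 0 &
      qnormsq c + qnormsq d = 1].
Proof.
have n0 : qnormsq (0 : H) = 0 by apply/eqP; rewrite qnormsq_eq0.
have [->|a0] := eqVneq a 0.
  rewrite n0 add0r => b1; exists 1, 0; rewrite n0 qnormsq1; split.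
  - by apply: Sp2_qmx2; rewrite ?n0 ?qnormsq1 ?addr0 ?add0r // mulr0 addr0;
      apply: quat_ext => /=; ring.
  - by apply: quat_ext => /=; ring.
  - by rewrite addr0.
move=> ab1; have na := qnormsq_gt0 a0.
pose n := Num.sqrt (qnormsq a); have n2 : n ^+ 2 = qnormsq a by rewrite sqr_sqrtr ?ltW.
have nn : n != 0 by rewrite gt_eqF // sqrtr_gt0.
have e1 : n^-1 * qnormsq a = n by rewrite -n2 expr2 mulKf.
pose c := - n^-1 *: (qconj b * a); pose d : H := n%:A.
have nc : qnormsq c = qnormsq b.
  rewrite /c qnormsqZ qnormsqM qnormsq_conj sqrrN exprVn n2.
  by rewrite mulrCA mulVf ?mulr1 // gt_eqF.
have nd : qnormsq d = qnormsq a by rewrite /d qnormsqZ qnormsq1 mulr1 n2.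
exists c, d; split; last by rewrite nc nd addrC.
  apply: Sp2_qmx2; rewrite ?nc ?nd // 1?addrC //.
  rewrite /c /d qconjZ qconjM qconjK -scalerAr mulr1 scalerA mulrN mulfV //.
  by rewrite scaleN1r addNr.
rewrite /c /d -scalerAl -mulrA mul_qconj -scalerAr mulr1 scalerA mulNr e1.
by rewrite -scalerAl mul1r -scalerDl addNr scale0r.
Qed.

Definition reach U W := exists2 g, Sp2Sp1 g & (g @: U)%VS = W.

Lemma reach_trans V U W : reach U V -> reach V W -> reach U W.
Proof.
move=> [g Gg <-] [h Gh <-]; exists (h \o g)%VF; first exact: Sp2Sp1_comp.
by rewrite limg_comp.
Qed.

Lemma qconj_unit_mul (q : H) : qnormsq q = 1 -> qconj q * q = 1.
Proof. by move=> q1; rewrite qconj_mul q1 scale1r. Qed.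

Lemma mul_unit_qconj (q : H) : qnormsq q = 1 -> q * qconj q = 1.
Proof. by move=> q1; rewrite mul_qconj q1 scale1r. Qed.

Lemma hprod_lmult A v w : Sp2 A -> hprod (lmult A v) (lmult A w) = hprod v w.
Proof.
move=> /Sp2E sA; rewrite /hprod /=.
have := (sA ord0 ord0, sA ord0 ord_max, sA ord_max ord0, sA ord_max ord_max).
move: (A ord0 ord0) (A ord0 ord_max) (A ord_max ord0) (A ord_max ord_max).
move=> a b c d [[[e1 e2] e3] e4].
transitivity (qconj v.1 * (qconj a * a + qconj c * c) * w.1
  + qconj v.1 * (qconj a * b + qconj c * d) * w.2
  + qconj v.2 * (qconj b * a + qconj d * c) * w.1
  + qconj v.2 * (qconj b * b + qconj d * d) * w.2).
  by apply: quat_ext => /=; ring.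
rewrite e1 e2 e3 e4 /=. by rewrite !mulr0 !mul0r !mulr1 !addr0.
Qed.

Lemma hprod_rmult q v w : hprod (rmult q v) (rmult q w) = qconj q * hprod v w * q.
Proof. by rewrite /hprod /= !qconjM mulrDr mulrDl !mulrA. Qed.

Lemma hprodvv v : hprod v v = (qnormsq v.1 + qnormsq v.2)%:A.
Proof. by rewrite /hprod /qnormsq; apply: quat_ext => /=; ring. Qed.

Lemma hprod_eq0 v : hprod v v = 0 -> v = 0.
Proof.
move/(congr1 (@q0 R)); rewrite hprodvv /= mulr1 => /eqP.
rewrite paddr_eq0 ?qnormsq_ge0 // !qnormsq_eq0 => /andP[/eqP v1 /eqP v2].
by case: v v1 v2 => /= ? ? -> ->.
Qed.

Lemma conj_hom_inj (f : 'End(quat2 R)) q :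
  (forall v w, hprod (f v) (f w) = qconj q * hprod v w * q) ->
  qnormsq q = 1 -> lker f == 0%VS.
Proof.
move=> fh q1; rewrite -subv0; apply/subvP => v; rewrite memv_ker memv0 => /eqP fv.
apply/eqP/hprod_eq0; have := fh v v; rewrite fv.
have -> : hprod 0 0 = 0 :> H by rewrite /hprod /= !mulr0 addr0.
move=> e; have <- : q * (qconj q * hprod v v * q) * qconj q = hprod v v.
  by rewrite !mulrA mul_unit_qconj // mul1r -mulrA mul_unit_qconj // mulr1.
by rewrite -e mulr0 mul0r.
Qed.

(** Left factors preserve the product K and right factors conjugate it; this
    is the only information on the group that the uniqueness part retains. *)
Lemma Sp2Sp1_hprod (f : 'End(quat2 R)) : Sp2Sp1 f -> exists q, qnormsq q = 1 /\
  forall v w, hprod (f v) (f w) = qconj q * hprod v w * q.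
Proof.
elim=> {f} [A sA|q q1||f g _ [p [p1 fp]] _ [q [q1 gq]]|f _ [q [q1 fq]]].
- exists 1; split=> [|v w]; first exact: qnormsq1.
  rewrite !lfunE /= hprod_lmult //; apply: quat_ext => /=; ring.
- by exists q; split=> // v w; rewrite !lfunE /= hprod_rmult.
- exists 1; split=> [|v w]; first exact: qnormsq1.
  rewrite !lfunE /=; apply: quat_ext => /=; ring.
- exists (q * p); split=> [|v w]; first by rewrite qnormsqM p1 q1 mulr1.
  by rewrite !lfunE /= fp gq qconjM !mulrA.
- exists (qconj q); rewrite qnormsq_conj; split=> // v w.
  have kf := conj_hom_inj fq q1.
  have := fq ((f^-1)%VF v) ((f^-1)%VF w); rewrite !lker0_lfunVK // => ->.
  rewrite qconjK !mulrA mul_unit_qconj // mul1r -!mulrA mul_unit_qconj //.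
  by rewrite mulr1.
Qed.

Lemma Sp2Sp1_inj (f : 'End(quat2 R)) : Sp2Sp1 f -> lker f == 0%VS.
Proof. by case/Sp2Sp1_hprod => q [q1 fq]; exact: conj_hom_inj fq q1. Qed.

Lemma reach_sym U W : reach U W -> reach W U.
Proof.
move=> [g Gg <-]; exists (g^-1)%VF; first exact: Sp2Sp1_inv.
by rewrite -limg_comp lker0_compVf ?lim1g // Sp2Sp1_inj.
Qed.

Lemma dim_reach U W : reach U W -> \dim W = \dim U.
Proof.
move=> [g /Sp2Sp1_inj /eqP kg <-]; apply: limg_dim_eq.
by rewrite kg capv0.
Qed.

(** Written like [theta_span], which is therefore an [fspan] by conversion. *)
Definition fspan k (v : 'I_k -> quat2 R) : {vspace quat2 R} :=
  <<[seq v p | p : 'I_k]>>%VS.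

Lemma eq_fspan k (v w : 'I_k -> quat2 R) : v =1 w -> fspan v = fspan w.
Proof. by move=> vw; congr (<< _ >>)%VS; apply: eq_map. Qed.

Lemma mem_fspan k (v : 'I_k -> quat2 R) p : v p \in fspan v.
Proof. by apply: memv_span; apply: map_f; rewrite mem_enum. Qed.

Lemma fspan_sub k (v : 'I_k -> quat2 R) W :
  (forall p, v p \in W) -> (fspan v <= W)%VS.
Proof. by move=> vW; apply/span_subvP => x /mapP[p _ ->]. Qed.

Lemma fspan_mul k (v w : 'I_k -> quat2 R) (A : 'M[R]_k) :
  A \in unitmx -> (forall p, w p = \sum_r A p r *: v r) -> fspan w = fspan v.
Proof.
move=> uA wE; apply/eqP; rewrite eqEsubv !fspan_sub //= => p.
  have -> : v p = \sum_r invmx A p r *: w r.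
    transitivity (\sum_s (invmx A *m A) p s *: v s).
      rewrite mulVmx // (bigD1 p) //= !mxE eqxx scale1r big1 ?addr0 // => s sp.
      by rewrite mxE eq_sym (negPf sp) scale0r.
    under eq_bigr do rewrite mxE scaler_suml.
    rewrite exchange_big; apply: eq_bigr => r _.
    by rewrite wE scaler_sumr; apply: eq_bigr => s _; rewrite scalerA.
  by apply: memv_suml => r _; apply: memvZ; exact: mem_fspan.
by rewrite wE; apply: memv_suml => r _; apply: memvZ; exact: mem_fspan.
Qed.

Lemma fspan_scale k (v : 'I_k -> quat2 R) (a : 'I_k -> R) :
  (forall p, a p != 0) -> fspan (fun p => a p *: v p) = fspan v.
Proof.
move=> a0; apply/eqP; rewrite eqEsubv !fspan_sub //= => p.
  rewrite -[v p]scale1r -(mulVf (a0 p)) -scalerA memvZ //.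
  exact: (mem_fspan (fun p => a p *: v p)).
by rewrite memvZ // mem_fspan.
Qed.

Lemma reach_fspan k (g : 'End(quat2 R)) (v : 'I_k -> quat2 R) :
  Sp2Sp1 g -> reach (fspan v) (fspan (fun p => g (v p))).
Proof. by move=> Gg; exists g => //; rewrite limg_span -map_comp. Qed.

Lemma reach_lmult k A (v : 'I_k -> quat2 R) :
  Sp2 A -> reach (fspan v) (fspan (fun p => lmult A (v p))).
Proof.
move=> sA.
have <- : fspan (fun p => linfun (lmult A) (v p)) = fspan (fun p => lmult A (v p)).
  by apply: eq_fspan => p; rewrite lfunE.
by apply: reach_fspan; exact: Sp2Sp1_left.
Qed.

Lemma reach_rmult k q (v : 'I_k -> quat2 R) :
  qnormsq q = 1 -> reach (fspan v) (fspan (fun p => rmult q (v p))).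
Proof.
move=> q1.
have <- : fspan (fun p => linfun (rmult q) (v p)) = fspan (fun p => rmult q (v p)).
  by apply: eq_fspan => p; rewrite lfunE.
by apply: reach_fspan; exact: Sp2Sp1_right.
Qed.

Definition normalizable k U := exists2 theta : 'I_k -> R,
  (forall p, 0 <= theta p <= 2 * pi) & reach U (theta_span theta).

(** A nonzero real vector (a, b) is a multiple of some (cos t, sin t), so only
    the shape of the frame matters, not its normalisation. *)
Lemma normalizable_real k (U : {vspace quat2 R}) (a b : 'I_k -> R) :
  (forall p, a p ^+ 2 + b p ^+ 2 != 0) ->
  reach U (fspan (fun p => rmult (unit_of R p) ((a p)%:A, (b p)%:A))) ->
  normalizable k U.
Proof.
move=> ab0 UE.
pose n p := Num.sqrt (a p ^+ 2 + b p ^+ 2).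
have n2 p : n p ^+ 2 = a p ^+ 2 + b p ^+ 2 by rewrite sqr_sqrtr // addr_ge0 ?sqr_ge0.
have n0 p : n p != 0 by rewrite -sqrf_eq0 n2.
have h p : exists t, 0 <= t <= 2 * pi /\ cos t = a p / n p /\ sin t = b p / n p.
  have [|t tb tE] := @exists_angle (a p / n p) (b p / n p); last by exists t.
  by rewrite !exprMn -mulrDl exprVn -n2 divff // sqrf_eq0.
have [theta thE] := choice h.
exists theta => [p|]; first by case: (thE p).
congr (reach _ _): UE.
rewrite -[RHS]/(fspan (theta_vec theta)) -(@fspan_scale _ (theta_vec theta) n) //.
apply: eq_fspan => p; have [_ [tc ts]] := thE p.
rewrite /theta_vec tc ts /rmult /=; congr pair;
  by rewrite -!scalerAl scalerA mulrCA mulfV ?mulr1.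
Qed.

End Action.

(** * Gram matrices of real frames *)

Section Gram.
Variable R : realType.
Local Notation H := (quat R).
Implicit Types (v w : quat2 R) (k : nat).

Lemma hprodC v w : hprod w v = qconj (hprod v w).
Proof. by rewrite /hprod qconjD !qconjM !qconjK. Qed.

Lemma hprodDr v w w' : hprod v (w + w') = hprod v w + hprod v w'.
Proof. by rewrite /hprod /= !mulrDr addrACA. Qed.

Lemma hprodZr a v w : hprod v (a *: w) = a *: hprod v w.
Proof. by rewrite /hprod /= -!scalerAr -scalerDr. Qed.

Lemma hprodDl v v' w : hprod (v + v') w = hprod v w + hprod v' w.
Proof. by rewrite hprodC hprodDr qconjD -!hprodC. Qed.

Lemma hprodZl a v w : hprod (a *: v) w = a *: hprod v w.
Proof. by rewrite hprodC hprodZr qconjZ -hprodC. Qed.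

Lemma hprod0r v : hprod v 0 = 0.
Proof. by rewrite -(scale0r (0 : quat2 R)) hprodZr scale0r. Qed.

Lemma hprod0l v : hprod 0 v = 0.
Proof. by rewrite -(scale0r (0 : quat2 R)) hprodZl scale0r. Qed.

Lemma hprod_sum k (a b : 'I_k -> R) (v w : 'I_k -> quat2 R) :
  hprod (\sum_r a r *: v r) (\sum_s b s *: w s) =
  \sum_r \sum_s (a r * b s) *: hprod (v r) (w s).
Proof.
rewrite (big_morph (fun x => hprod x _) (fun x y => hprodDl x y _) (hprod0l _)).
apply: eq_bigr => r _.
rewrite (big_morph (hprod _) (hprodDr _) (hprod0r _)); apply: eq_bigr => s _.
by rewrite hprodZr hprodZl scalerA mulrC.
Qed.

Lemma q0_sum (I : Type) (r : seq I) (f : I -> H) :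
  q0 (\sum_(i <- r) f i) = \sum_(i <- r) q0 (f i).
Proof. exact: (big_morph (@q0 R)). Qed.

Lemma q0Z a (x : H) : q0 (a *: x) = a * q0 x.
Proof. by []. Qed.

Lemma q0D (x y : H) : q0 (x + y) = q0 x + q0 y.
Proof. by []. Qed.

Lemma q0_conj (x : H) : q0 (qconj x) = q0 x.
Proof. by []. Qed.

Lemma qim_sum (I : Type) (r : seq I) (f : I -> H) b :
  qim (\sum_(i <- r) f i) b = \sum_(i <- r) qim (f i) b.
Proof.
apply: (big_morph (fun x => qim x b)) => [x y|];
  by elim/ord3_ind: b; rewrite /qim /= ?inordK.
Qed.

Lemma qimZ a (x : H) b : qim (a *: x) b = a * qim x b.
Proof. by elim/ord3_ind: b; rewrite /qim /= ?inordK. Qed.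

Lemma qim_conj (x : H) b : qim (qconj x) b = - qim x b.
Proof. by elim/ord3_ind: b; rewrite /qim /= ?inordK. Qed.

Lemma q0_conjugate (q x : H) : q0 (qconj q * x * q) = qnormsq q * q0 x.
Proof. by rewrite /qnormsq /=; ring. Qed.

Lemma qim_conjugate (q x : H) b :
  qim (qconj q * x * q) b = \sum_c qrot q c b * qim x c.
Proof.
rewrite !big_ord_recr big_ord0 /= add0r !mxE /qim /=.
by elim/ord3_ind: b; rewrite /= ?inordK //=; ring.
Qed.

(** The quaternionic Gram matrix of a frame is split into four real matrices,
    because a real change of frame acts on each of them by congruence, while a
    conjugation of the quaternions mixes the last three by a rotation. *)
Definition re_mx k (v : 'I_k -> quat2 R) : 'M[R]_k :=
  \matrix_(r, s) q0 (hprod (v r) (v s)).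
Definition im_mx k (v : 'I_k -> quat2 R) (b : 'I_3) : 'M[R]_k :=
  \matrix_(r, s) qim (hprod (v r) (v s)) b.

Lemma tr_im_mx k (v : 'I_k -> quat2 R) b : (im_mx v b)^T = - im_mx v b.
Proof. by apply/matrixP => r s; rewrite !mxE hprodC qim_conj. Qed.

Lemma congruence_mxE k (A M : 'M[R]_k) i j :
  (A *m M *m A^T) i j = \sum_r \sum_s A i r * A j s * M r s.
Proof.
rewrite mxE exchange_big; apply: eq_bigr => s _ /=; rewrite !mxE mulr_suml.
by apply: eq_bigr => r _; rewrite mulrAC.
Qed.

Lemma re_mx_mul k (v w : 'I_k -> quat2 R) (A : 'M[R]_k) :
  (forall p, w p = \sum_r A p r *: v r) -> re_mx w = A *m re_mx v *m A^T.
Proof.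
move=> wE; apply/matrixP => i j; rewrite congruence_mxE !mxE !wE hprod_sum.
rewrite q0_sum; apply: eq_bigr => r _; rewrite q0_sum; apply: eq_bigr => s _.
by rewrite mxE.
Qed.

Lemma im_mx_mul k (v w : 'I_k -> quat2 R) (A : 'M[R]_k) b :
  (forall p, w p = \sum_r A p r *: v r) -> im_mx w b = A *m im_mx v b *m A^T.
Proof.
move=> wE; apply/matrixP => i j; rewrite congruence_mxE !mxE !wE hprod_sum.
rewrite qim_sum; apply: eq_bigr => r _; rewrite qim_sum; apply: eq_bigr => s _.
by rewrite qimZ mxE.
Qed.

Lemma re_mx_conj k (v w : 'I_k -> quat2 R) q : qnormsq q = 1 ->
  (forall r s, hprod (w r) (w s) = qconj q * hprod (v r) (v s) * q) ->
  re_mx w = re_mx v.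
Proof.
by move=> q1 wE; apply/matrixP => r s; rewrite !mxE wE q0_conjugate q1 mul1r.
Qed.

Lemma im_mx_conj k (v w : 'I_k -> quat2 R) q b :
  (forall r s, hprod (w r) (w s) = qconj q * hprod (v r) (v s) * q) ->
  im_mx w b = \sum_c qrot q c b *: im_mx v c.
Proof.
move=> wE; apply/matrixP => r s; rewrite summxE !mxE wE qim_conjugate.
by apply: eq_bigr => c _; rewrite !mxE.
Qed.

Definition orthonormal k (v : 'I_k -> quat2 R) := re_mx v = 1%:M.

Lemma orthonormalP k (v : 'I_k -> quat2 R) :
  orthonormal v <-> forall p q, q0 (hprod (v p) (v q)) = (p == q)%:R.
Proof.
split=> [/matrixP e p q|e]; first by have := e p q; rewrite !mxE.
by apply/matrixP => p q; rewrite !mxE e.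
Qed.

Lemma orthonormal_coef k (v : 'I_k -> quat2 R) (c : 'I_k -> R) p :
  orthonormal v -> q0 (hprod (v p) (\sum_r c r *: v r)) = c p.
Proof.
move=> /orthonormalP ov.
rewrite (big_morph (hprod _) (hprodDr _) (hprod0r _)) q0_sum (bigD1 p) //.
rewrite hprodZr q0Z ov eqxx mulr1 big1 => [|r rp]; first exact: addr0.
by rewrite hprodZr q0Z ov eq_sym (negPf rp) mulr0.
Qed.

Lemma orthonormal_dim k (v : 'I_k -> quat2 R) : orthonormal v -> \dim (fspan v) = k.
Proof.
move=> ov; suff fv : free [tuple v p | p < k].
  by have := eqP fv; rewrite size_tuple => e; rewrite -[RHS]e.
apply/freeP => c ce p; rewrite -(orthonormal_coef c p ov).
rewrite (_ : \sum_r _ = 0) ?hprod0r // -[RHS]ce; apply: eq_bigr => r _.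
by rewrite -tnth_nth tnth_mktuple.
Qed.

(** One Gram-Schmidt step at a time. *)
Lemma exists_orthonormal_in (U : {vspace quat2 R}) n : (n <= \dim U)%N ->
  exists2 v : 'I_n -> quat2 R, orthonormal v & forall p, v p \in U.
Proof.
elim: n => [|n IHn] hn.
  by exists (fun=> 0) => [|[]//]; apply/orthonormalP => -[].
have [v ov vU] := IHn (ltnW hn).
have /subvPn[u uU uv] : ~~ (U <= fspan v)%VS.
  by apply: contraL hn => /dimvS; rewrite orthonormal_dim // -leqNgt.
pose c p := q0 (hprod (v p) u); pose u' := u - \sum_r c r *: v r.
have u'v p : q0 (hprod (v p) u') = 0.
  have -> : u' = u + (-1) *: \sum_r c r *: v r by rewrite scaleN1r.
  by rewrite hprodDr q0D hprodZr q0Z orthonormal_coef // mulN1r subrr.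
have u'0 : u' != 0.
  apply: contra uv => /eqP/(canRL (subrK _)); rewrite add0r => ->.
  by apply: memv_suml => r _; rewrite memvZ // mem_fspan.
pose n2 := q0 (hprod u' u').
have n2_gt0 : 0 < n2.
  have nE : n2 = qnormsq u'.1 + qnormsq u'.2 by rewrite /n2 hprodvv q0Z mulr1.
  rewrite lt_neqAle {2}nE addr_ge0 ?qnormsq_ge0 // andbT eq_sym.
  apply: contra u'0 => /eqP n20; apply/eqP/hprod_eq0.
  by rewrite hprodvv -nE n20 scale0r.
pose e := (Num.sqrt n2)^-1 *: u'.
have ee : q0 (hprod e e) = 1.
  rewrite /e hprodZl hprodZr q0Z mulrA -expr2 exprVn sqr_sqrtr ?ltW //.
  by rewrite mulVf ?gt_eqF.
have ev p : q0 (hprod (v p) e) = 0 by rewrite /e hprodZr q0Z u'v mulr0.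
have ve p : q0 (hprod e (v p)) = 0 by rewrite hprodC q0_conj ev.
exists (fun p => if unlift ord_max p is Some r then v r else e).
  apply/orthonormalP => p q.
  case: unliftP => [r|] ->; case: unliftP => [s|] ->.
  - by rewrite (inj_eq lift_inj); move/orthonormalP: ov.
  - by rewrite ev eq_sym eq_liftF.
  - by rewrite ve eq_liftF.
  - by rewrite ee eqxx.
move=> p; case: unliftP => [r _ //|_].
rewrite memvZ // memvB //; apply: memv_suml => r _; by rewrite memvZ.
Qed.

Lemma exists_orthonormal_basis (U : {vspace quat2 R}) k : \dim U = k ->
  exists2 v : 'I_k -> quat2 R, orthonormal v & U = fspan v.
Proof.
move=> dU; have [|v ov vU] := @exists_orthonormal_in U k; first by rewrite dU.
exists v => //; apply/esym/eqP; rewrite eqEdim orthonormal_dim // dU leqnn andbT.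
exact: fspan_sub.
Qed.

End Gram.

(** * Normal forms of 2-planes and 3-planes *)

Section SmallPlanes.
Variable R : realType.
Local Notation H := (quat R).

(** An element of Sp(2) whose first row is the conjugate of the first vector
    moves that vector to (1, 0); the other vectors then have their products
    with it as first coordinates. *)
Lemma reach_first k (v : 'I_k.+1 -> quat2 R) : orthonormal v ->
  exists w : 'I_k.+1 -> quat2 R, [/\ reach (fspan v) (fspan w), w ord0 = (1, 0) &
    forall p q, hprod (w p) (w q) = hprod (v p) (v q)].
Proof.
move=> /orthonormalP/(_ ord0 ord0); rewrite hprodvv q0Z mulr1 eqxx => v1.
have [|c [d [sA cd _]]] := @Sp2_complete R (qconj (v ord0).1) (qconj (v ord0).2).
  by rewrite !qnormsq_conj.
exists (fun p => lmult (qmx2 (qconj (v ord0).1) (qconj (v ord0).2) c d) (v p)).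
split; first exact: reach_lmult; last by move=> p q; exact: hprod_lmult.
rewrite lmult_qmx2; congr pair; last by rewrite -[RHS]cd !qconjK.
by rewrite !qconj_mul -scalerDl v1 scale1r.
Qed.

(** With n the norm of x, the quaternion z = x + n i satisfies x z = z (n i)
    because x^2 = - n^2. *)
Lemma imaginary_conj_qi (x : H) : q0 x = 0 -> exists2 q, qnormsq q = 1 &
  exists a, qconj q * x * q = a *: qi.
Proof.
move=> x0; pose n := Num.sqrt (qnormsq x).
have n2 : n ^+ 2 = qnormsq x by rewrite sqr_sqrtr ?qnormsq_ge0.
have [z0|z0] := eqVneq (x + n *: qi) 0.
  exists 1; first exact: qnormsq1.
  by exists (- n); move/eqP: z0; rewrite addr_eq0 => /eqP ->; apply: quat_ext => /=; ring.
exists (qunit (x + n *: qi)); first exact: qnormsq_unit.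
exists n; have xz : x * (x + n *: qi) = (x + n *: qi) * (n *: qi).
  move: n2; rewrite /qnormsq x0 expr0n add0r => n2.
  by apply: quat_ext => /=; rewrite x0; lra.
have -> : qconj (qunit (x + n *: qi)) * x * qunit (x + n *: qi) =
    qconj (qunit (x + n *: qi)) * (qunit (x + n *: qi) * (n *: qi)).
  by rewrite {2 3}/qunit -scalerAl -xz scalerAr mulrA.
by rewrite mulrA qconj_unit_mul ?qnormsq_unit // mul1r.
Qed.

(** The frames (1, 0), (a i, y), (b j, z) with y^* z along k: the left factor on the
    second coordinate makes y a multiple of i, and then z is a multiple of j;
    when y = 0 it is z that is moved. *)
Lemma align_second (y z : H) (c : R) : qconj y * z = c *: qk ->
  exists2 p, qnormsq p = 1 & exists r s, p * y = r *: qi /\ p * z = s *: qj.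
Proof.
have nrm (e x : H) : x != 0 -> qnormsq e = 1 ->
    qnormsq ((Num.sqrt (qnormsq x))^-1 *: (e * qconj x)) = 1.
  move=> x0 e1; rewrite qnormsqZ qnormsqM qnormsq_conj e1 mul1r -qnormsqZ.
  exact: qnormsq_unit.
have nqi : qnormsq (qi : H) = 1 by rewrite /qnormsq /=; ring.
have nqj : qnormsq (qj : H) = 1 by rewrite /qnormsq /=; ring.
move=> yz; have [y0|y0] := eqVneq y 0; last first.
  exists ((Num.sqrt (qnormsq y))^-1 *: (qi * qconj y)); first exact: nrm.
  exists ((Num.sqrt (qnormsq y))^-1 * qnormsq y), (- ((Num.sqrt (qnormsq y))^-1 * c)).
  rewrite -!scalerAl -!mulrA yz qconj_mul; split; apply: quat_ext => /=; ring.
have [z0|z0] := eqVneq z 0.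
  exists 1; first exact: qnormsq1.
  by exists 0, 0; rewrite y0 z0 !mulr0 !scale0r.
exists ((Num.sqrt (qnormsq z))^-1 *: (qj * qconj z)); first exact: nrm.
exists 0, ((Num.sqrt (qnormsq z))^-1 * qnormsq z).
rewrite y0 mulr0 scale0r -!scalerAl -!mulrA qconj_mul; split=> //.
by apply: quat_ext => /=; ring.
Qed.

Lemma qnormsq_unit_of p : qnormsq (unit_of R p) = 1.
Proof. by case: p => [|[|[|p]]]; rewrite /qnormsq /=; ring. Qed.

Lemma normalizable_frame k (U : {vspace quat2 R}) (w : 'I_k -> quat2 R)
    (p : H) (a b : 'I_k -> R) :
  qnormsq p = 1 -> orthonormal w -> reach U (fspan w) ->
  (forall i, (w i).1 = a i *: unit_of R i) ->
  (forall i, p * (w i).2 = b i *: unit_of R i) -> normalizable k U.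
Proof.
move=> p1 /orthonormalP ow Uw wa wb.
apply: (@normalizable_real _ _ _ a b) => [i|].
  have nw : qnormsq (w i).1 + qnormsq (w i).2 = 1.
    by have := ow i i; rewrite eqxx hprodvv q0Z mulr1.
  suff -> : a i ^+ 2 + b i ^+ 2 = qnormsq (w i).1 + qnormsq (w i).2.
    by rewrite nw oner_neq0.
  rewrite -[qnormsq (w i).2]mul1r -p1 -qnormsqM wa wb !qnormsqZ.
  by rewrite !qnormsq_unit_of !mulr1.
apply: reach_trans Uw _.
have := reach_lmult w (Sp2_diag (qnormsq1 R) p1); congr reach.
apply: eq_fspan => i; rewrite lmult_qmx2 !mul0r add0r addr0 mul1r wa wb.
by rewrite /rmult /= -!scalerAl !mul1r.
Qed.

Lemma fst_hprod (v w : quat2 R) : v = (1, 0) -> w.1 = hprod v w.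
Proof. by move=> ->; rewrite /hprod /=; apply: quat_ext => /=; ring. Qed.

Lemma normalizable2 (v : 'I_2 -> quat2 R) : orthonormal v -> normalizable 2 (fspan v).
Proof.
move=> ov; have k0 := (orthonormalP v).1 ov ord0 ord_max.
have [q q1 [a qE]] := imaginary_conj_qi k0.
pose v' p := rmult q (v p).
have ov' : orthonormal v'.
  by rewrite /orthonormal (@re_mx_conj _ _ v _ q) // => r s; exact: hprod_rmult.
have [w [rw w0 hw]] := reach_first ov'.
have [|p p1 [r [s [pr _]]]] := @align_second (w ord_max).2 0 0.
  by rewrite mulr0 scale0r.
apply: (@normalizable_frame _ _ w p (fun i => if i == ord0 then 1 else a)
                               (fun i => if i == ord0 then 0 else r)) => //.
- by apply/orthonormalP => i j; rewrite hw; apply/orthonormalP: i j.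
- by apply: reach_trans (reach_rmult v q1) rw.
- elim/ord2_ind; rewrite /= (fst_hprod _ w0) hw; last by rewrite hprod_rmult qE.
  by rewrite -hw w0 /hprod /=; apply: quat_ext => /=; ring.
- by elim/ord2_ind; rewrite /= ?pr // w0 mulr0 scale0r.
Qed.

Definition axial (M : 'M[R]_3) (a : 'I_3) : R :=
  [:: M (inord 1) (inord 2); M (inord 2) ord0; M ord0 (inord 1)]`_a.

(** A rotation is its own cofactor matrix, so that it acts on the axial vector
    of a skew matrix in the same way as on vectors. *)
Lemma axial_congruence (p : H) (M : 'M[R]_3) a : M^T = - M ->
  axial (qrot p *m M *m (qrot p)^T) a =
  qnormsq p * \sum_c qrot p a c * axial M c.
Proof.
move=> /matrixP sk.
have d i : M i i = 0 by have := sk i i; rewrite !mxE; lra.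
have e10 : M (inord 1) ord0 = - M ord0 (inord 1) by have := sk (inord 1) ord0; rewrite !mxE; lra.
have e02 : M ord0 (inord 2) = - M (inord 2) ord0 by have := sk ord0 (inord 2); rewrite !mxE; lra.
have e21 : M (inord 2) (inord 1) = - M (inord 1) (inord 2) by have := sk (inord 2) (inord 1); rewrite !mxE; lra.
rewrite sum3E.
by elim/ord3_ind: a; rewrite /axial /= ?inordK //= !mulmx3E !mxE /= ?inordK //=
  !d ?e10 ?e02 ?e21 /qnormsq; ring.
Qed.

Lemma tr_qrot (p : H) : (qrot p)^T = qrot (qconj p).
Proof.
apply/matrixP => i j; rewrite !mxE.
by elim/ord3_ind: i; elim/ord3_ind: j; rewrite /= ?inordK //=; ring.
Qed.

Lemma qrot_orthogonal (p : H) : qnormsq p = 1 -> qrot p *m (qrot p)^T = 1%:M.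
Proof. by move=> p1; rewrite tr_qrot -qrotM mul_unit_qconj // qrot1. Qed.

Lemma axialD M N a : axial (M + N) a = axial M a + axial N a.
Proof. by elim/ord3_ind: a; rewrite /axial /= ?inordK //= !mxE. Qed.

Lemma axialZ c M a : axial (c *: M) a = c * axial M a.
Proof. by elim/ord3_ind: a; rewrite /axial /= ?inordK //= !mxE. Qed.

(** The singular value decomposition of the matrix of the axial vectors of the
    three coordinates of the Gram matrix: the left rotation is the change of
    basis, the right one the factor in Sp(1). *)
Lemma diagonal_frame3 (v : 'I_3 -> quat2 R) : orthonormal v ->
  exists w : 'I_3 -> quat2 R, [/\ reach (fspan v) (fspan w), orthonormal w &
    forall a b, a != b -> axial (im_mx w b) a = 0].
Proof.
move=> ov; pose T : 'M[R]_3 := \matrix_(a, b) axial (im_mx v b) a.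
have [p [q [p1 q1 diag]]] := rotation_svd T.
pose u r := \sum_s qrot p r s *: v s; pose w r := rmult q (u r).
have hw r s : hprod (w r) (w s) = qconj q * hprod (u r) (u s) * q.
  exact: hprod_rmult.
exists w; split.
- suff <- : fspan u = fspan v by exact: (reach_rmult u q1).
  by apply: (@fspan_mul _ _ v u (qrot p)) => //; have [] := mulmx1_unit (qrot_orthogonal p1).
- rewrite /orthonormal (re_mx_conj q1 hw) (@re_mx_mul _ _ v u (qrot p)) // ov.
  by rewrite mulmx1 qrot_orthogonal.
- move=> a b /diag; rewrite mulmx3E => <-.
  rewrite (im_mx_conj _ hw) sum3E !axialD !axialZ.
  have uE c : axial (im_mx u c) a = (qrot p *m T) a c.
    rewrite (@im_mx_mul _ _ v u (qrot p)) // axial_congruence ?tr_im_mx // p1 mul1r.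
    by rewrite [RHS]mxE; apply: eq_bigr => d _; rewrite [T _ _]mxE.
  by rewrite !uE; ring.
Qed.

Lemma imaginary_unit (x : H) (b : 'I_3) : q0 x = 0 ->
  (forall c, c != b -> qim x c = 0) -> x = qim x b *: unit_of R b.+1.
Proof.
move=> x0 xb.
have e c : qim x c = if c == b then qim x b else 0.
  by case: eqVneq => [->//|/xb].
move: (e ord0) (e (inord 1)) (e (inord 2)); elim/ord3_ind: b {xb e};
  rewrite -!val_eqE /= !inordK //= /qim /= ?inordK //= => x1 x2 x3;
  by apply: quat_ext; rewrite /= ?x0 ?x1 ?x2 ?x3; ring.
Qed.

Lemma normalizable3 (v : 'I_3 -> quat2 R) : orthonormal v -> normalizable 3 (fspan v).
Proof.
move=> /diagonal_frame3[u [vu /orthonormalP ou diag]].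
have ur : fspan (fun i => u (rev_ord i)) = fspan u.
  apply/eqP; rewrite eqEsubv !fspan_sub // => p; last exact: mem_fspan.
  by rewrite -[p]rev_ordK (mem_fspan (fun i => u (rev_ord i))).
have [|w [rw w0 hw]] := @reach_first _ (fun i => u (rev_ord i)).
  by apply/orthonormalP => p q; rewrite ou (inj_eq rev_ord_inj).
(* the units i, j, k of [u] lie on the pairs 12, 20, 01: reversing the order
   puts them on 01, 02, 12, as in M_lambda *)
have r0 : rev_ord ord0 = inord 2 :> 'I_3 by apply/val_inj; rewrite /= inordK.
have r1 : rev_ord (inord 1) = inord 1 :> 'I_3 by apply/val_inj; rewrite /= !inordK.
have r2 : rev_ord (inord 2) = ord0 :> 'I_3 by apply/val_inj; rewrite /= !inordK.
have N x y b : qim (hprod (u x) (u y)) b = im_mx u b x y by rewrite mxE.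
have Nsk b x y : im_mx u b x y = - im_mx u b y x.
  by have /matrixP/(_ y x) := tr_im_mx u b; rewrite !mxE.
have z0 c : c != ord0 -> im_mx u c (inord 2) (inord 1) = 0.
  by rewrite Nsk eq_sym => /diag; rewrite /axial /= => ->; rewrite oppr0.
have z1 c : c != inord 1 -> im_mx u c (inord 2) ord0 = 0.
  by rewrite eq_sym => /diag; rewrite /axial /= inordK.
have z2 c : c != inord 2 -> im_mx u c (inord 1) ord0 = 0.
  by rewrite Nsk eq_sym => /diag; rewrite /axial /= inordK //= => ->; rewrite oppr0.
have h01 : exists a, hprod (w ord0) (w (inord 1)) = a *: qi.
  rewrite hw r0 r1; eexists; apply: (@imaginary_unit _ ord0) => [|c /z0 <-].
    by rewrite ou -val_eqE /= !inordK.
  by rewrite N.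
have h02 : exists b, hprod (w ord0) (w (inord 2)) = b *: qj.
  rewrite hw r0 r2; have -> : qj = unit_of R (inord 1 : 'I_3).+1 by rewrite inordK.
  eexists; apply: (@imaginary_unit _ (inord 1)) => [|c /z1 <-].
    by rewrite ou -val_eqE /= !inordK.
  by rewrite N.
have h12 : exists c, hprod (w (inord 1)) (w (inord 2)) = c *: qk.
  rewrite hw r1 r2; have -> : qk = unit_of R (inord 2 : 'I_3).+1 by rewrite inordK.
  eexists; apply: (@imaginary_unit _ (inord 2)) => [|c /z2 <-].
    by rewrite ou -val_eqE /= !inordK.
  by rewrite N.
move: h01 h02 h12 => [a h01] [b h02] [c h12].
have [|p p1 [r [s [pr ps]]]] := @align_second (w (inord 1)).2 (w (inord 2)).2 (c + a * b).
  move: h12; rewrite {1}/hprod !(fst_hprod _ w0) h01 h02 => /(canRL (addKr _)) ->.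
  by apply: quat_ext => /=; ring.
apply: (@normalizable_frame _ _ w p (fun i => [:: 1; a; b]`_i) (fun i => [:: 0; r; s]`_i)) => //.
- by apply/orthonormalP => i j; rewrite hw ou (inj_eq rev_ord_inj).
- by rewrite -ur in vu; apply: reach_trans rw.
- elim/ord3_ind; rewrite /= ?inordK //= (fst_hprod _ w0) ?h01 ?h02 //.
  by rewrite w0 /hprod /=; apply: quat_ext => /=; ring.
- by elim/ord3_ind; rewrite /= ?inordK //= ?pr ?ps // w0 mulr0 scale0r.
Qed.

End SmallPlanes.

(** * Normal form of 4-planes *)

Section DeterminantExpansion.
Variable R : realType.

(** The reversed characteristic polynomial of - Q. *)
Lemma det_1p_poly n (Q : 'M[R]_n.+1) : exists P : {poly R},
  [/\ P`_0 = 1, P`_1 = \tr Q & forall t, \det (1%:M + t *: Q) = P.[t]].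
Proof.
pose c i := (char_poly (- Q))`_i.
have cn : c n.+1 = 1.
  by have /monicP := char_poly_monic (- Q); rewrite lead_coefE size_char_poly.
have cn1 : c n = \tr Q by rewrite /c char_poly_trace //= raddfN opprK.
exists (\poly_(j < n.+2) c (n.+1 - j)%N); rewrite !coef_poly /= subn0 subn1; split=> // t.
have [->|t0] := eqVneq t 0.
  by rewrite scale0r addr0 det1 horner_coef0 coef_poly /= subn0 cn.
have -> : 1%:M + t *: Q = t *: (t^-1%:M - (- Q)).
  by rewrite opprK scalerDr scale_scalar_mx mulfV.
rewrite detZ (_ : \det _ = (char_poly (- Q)).[t^-1]); last first.
  rewrite /char_poly -horner_evalE -det_map_mx; congr (\det _).
  apply/matrixP => i j; rewrite !mxE rmorphB rmorphMn /=.
  by rewrite !horner_evalE hornerX hornerC.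
rewrite horner_poly horner_coef size_char_poly mulr_sumr.
rewrite (reindex_inj rev_ord_inj); apply: eq_bigr => i _ /=.
rewrite subSS mulrCA; congr (_ * _).
have hi : (i <= n.+1)%N by rewrite -ltnS.
by rewrite exprVn -{1}(subnK (leq_subr i n.+1)) exprD subKn // mulfK // expf_neq0.
Qed.

Lemma poly_nonneg_coef1 (G : {poly R}) :
  (forall t, 0 <= G.[t]) -> G`_0 = 0 -> G`_1 = 0.
Proof.
move=> G0 G00; apply: oppr_inj; rewrite oppr0.
pose K : {poly R} := \poly_(i < size G) G`_i.+2.
have GE t : G.[t] = t * G`_1 + t ^+ 2 * K.[t].
  have -> : G = G`_1 *: 'X + 'X^2 * K.
    apply/polyP => i; rewrite coefD coefZ coefX coefXnM coef_poly.
    case: i => [|[|i]] /=; first by rewrite mulr0 addr0.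
      by rewrite mulr1 addr0.
    rewrite mulr0 add0r subn2 /=; case: ltnP => // h.
    by rewrite nth_default // (leq_trans h) // -addn2 leq_addr.
  by rewrite !hornerE /= coefD coefZ coefX coefXnM /= mulr1 addr0 mulrC.
apply: (@tangent_at_0 _ _ (\sum_(i < size K) `|K`_i|)) => t t1.
rewrite mulrN lerNl -subr_ge0 opprK.
apply: le_trans (G0 t) _; rewrite GE lerD2l ler_wpM2l ?sqr_ge0 //.
apply: le_trans (ler_norm _) _; rewrite horner_coef.
apply: le_trans (ler_norm_sum _ _ _) _; apply: ler_sum => i _.
by rewrite normrM normrX ler_piMr // exprn_ile1.
Qed.

Lemma poly_nonroot (P : {poly R}) : P != 0 -> exists2 t, t != 0 & P.[t] != 0.
Proof.
move=> P0; pose rs : seq R := [seq i.+1%:R | i <- iota 0 (size P)].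
have urs : uniq rs.
  by rewrite map_inj_uniq ?iota_uniq // => i j /eqP; rewrite eqr_nat => /eqP[].
have /allPn[t /mapP[i _ ->] rt] : ~~ all (root P) rs.
  apply/negP => /(max_poly_roots P0)/(_ urs).
  by rewrite size_map size_iota ltnn.
by exists i.+1%:R => //; rewrite pnatr_eq0.
Qed.

(** Since u (W + t B) = t u B, the row u B lies in the row space of W + t B; it
    is independent of a basis of the row space of W, and this remains true for
    some nonzero t after the basis is perturbed too. *)
Lemma rank_perturb m n (W B : 'M[R]_(m, n)) (u : 'rV[R]_m) :
  u *m W = 0 -> ~~ (u *m B <= W)%MS -> exists t, (\rank W < \rank (W + t *: B)%R)%N.
Proof.
move=> uW uB; have /submxP[D DW] : (row_base W <= W)%MS by rewrite eq_row_base.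
pose N := col_mx (row_base W) (u *m B).
have fN : row_free N.
  have : (\rank W < \rank N)%N.
    rewrite -[X in (X < _)%N](eq_row_base W); apply: rank_ltmx.
    apply/andP; split; first by rewrite -addsmxE addsmxSl.
    by rewrite col_mx_sub; apply: contra uB => /andP[_]; rewrite eq_row_base.
  by rewrite /row_free eqn_leq rank_leq_row /= -[X in (X <= _)%N -> _]addn1.
pose Q := col_mx (D *m B) (0 : 'rV[R]_n) *m pinvmx N.
have NE t : col_mx (D *m (W + t *: B)) (u *m B) *m pinvmx N = 1%:M + t *: Q.
  rewrite -(mulmxVp fN) /Q scalemxAl -mulmxDl; congr (_ *m _).
  rewrite scale_col_mx scaler0 add_col_mx addr0 mulmxDr -DW.
  by rewrite -scalemxAr.
have [t t0 dt] : exists2 t, t != 0 & \det (1%:M + t *: Q) != 0.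
  move: (Q) => {NE}; rewrite addn1 => Q'; have [P [P0 _ PE]] := det_1p_poly Q'.
  have [|t t0 Pt] := @poly_nonroot P; last by exists t; rewrite ?PE.
  by apply/eqP => P00; move/eqP: P0; rewrite P00 coef0 eq_sym oner_eq0.
exists t; suff : (\rank W + 1 <= \rank (W + t *: B)%R)%N by rewrite addn1.
have : row_free (col_mx (D *m (W + t *: B)) (u *m B)).
  apply/row_freeP; exists (pinvmx N *m invmx (1%:M + t *: Q)).
  by rewrite mulmxA NE mulmxV // unitmxE unitfE.
move/eqP => <-; apply: mxrankS; rewrite col_mx_sub.
apply/andP; split; first exact: submxMl.
have -> : u *m B = t^-1 *: u *m (W + t *: B).
  by rewrite mulmxDr -!scalemxAl uW scaler0 add0r -scalemxAr scalerA mulVf ?scale1r.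
exact: submxMl.
Qed.

End DeterminantExpansion.

Section FourPlanes.
Variable R : realType.
Local Notation H := (quat R).

Definition qcoef (x : H) (i : 'I_4) : R := [:: q0 x; q1 x; q2 x; q3 x]`_i.

Definition quat_mx (f : 'I_4 -> H) : 'M[R]_4 := \matrix_(p, i) qcoef (f p) i.

Lemma ord4_ind (P : 'I_4 -> Prop) :
  P ord0 -> P (inord 1) -> P (inord 2) -> P (inord 3) -> forall i, P i.
Proof.
move=> P0 P1 P2 P3 i.
have [|||] : [\/ i = ord0, i = inord 1, i = inord 2 | i = inord 3]; try by move->.
by case: i => -[|[|[|[|//]]]] hi; [constructor 1|constructor 2|constructor 3|constructor 4];
  apply/val_inj; rewrite /= ?inordK.
Qed.

Lemma sum4E (V : nmodType) (F : 'I_4 -> V) :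
  \sum_c F c = F ord0 + F (inord 1) + F (inord 2) + F (inord 3).
Proof.
rewrite !big_ord_recr big_ord0 /= add0r.
by congr (F _ + F _ + F _ + F _); apply/val_inj; rewrite /= ?inordK.
Qed.

Lemma qcoefD x y i : qcoef (x + y) i = qcoef x i + qcoef y i.
Proof. by elim/ord4_ind: i; rewrite /qcoef /= ?inordK. Qed.

Lemma qcoefZ a x i : qcoef (a *: x) i = a * qcoef x i.
Proof. by elim/ord4_ind: i; rewrite /qcoef /= ?inordK. Qed.

Lemma qcoef_sum (I : Type) (r : seq I) (f : I -> H) i :
  qcoef (\sum_(j <- r) f j) i = \sum_(j <- r) qcoef (f j) i.
Proof.
apply: (big_morph (fun x => qcoef x i)) => [x y|]; first exact: qcoefD.
by elim/ord4_ind: i; rewrite /qcoef /= ?inordK.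
Qed.

Lemma qcoef_unit (i j : 'I_4) : qcoef (unit_of R i) j = (i == j)%:R.
Proof.
by elim/ord4_ind: i; elim/ord4_ind: j; rewrite /qcoef -val_eqE /= ?inordK.
Qed.

Lemma qcoef_inj x y : qcoef x =1 qcoef y -> x = y.
Proof.
move=> xy; apply: quat_ext; [have := xy ord0|have := xy (inord 1)|
  have := xy (inord 2)|have := xy (inord 3)]; by rewrite /qcoef /= ?inordK.
Qed.

Lemma qcoefE x : x = \sum_(i < 4) qcoef x i *: unit_of R i.
Proof.
apply: qcoef_inj => j; rewrite qcoef_sum (bigD1 j) //= qcoefZ qcoef_unit eqxx mulr1.
by rewrite big1 ?addr0 // => i /negPf ij; rewrite qcoefZ qcoef_unit ij mulr0.
Qed.

Lemma quat_mx_unit : quat_mx (fun p => unit_of R p) = 1%:M.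
Proof. by apply/matrixP => p i; rewrite !mxE qcoef_unit. Qed.

Lemma quat_mxD f g : quat_mx (fun p => f p + g p) = quat_mx f + quat_mx g.
Proof. by apply/matrixP => p i; rewrite !mxE qcoefD. Qed.

Lemma quat_mxZ a f : quat_mx (fun p => a *: f p) = a *: quat_mx f.
Proof. by apply/matrixP => p i; rewrite !mxE qcoefZ. Qed.

Lemma eq_quat_mx f g : f =1 g -> quat_mx f = quat_mx g.
Proof. by move=> fg; apply/matrixP => p i; rewrite !mxE fg. Qed.

Lemma quat_mx_comb (A : 'M[R]_4) f :
  quat_mx (fun p => \sum_r A p r *: f r) = A *m quat_mx f.
Proof.
apply/matrixP => p i; rewrite !mxE qcoef_sum; apply: eq_bigr => r _.
by rewrite qcoefZ mxE.
Qed.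

(** The projection of the frame [v] to the first coordinate of H^2 after a
    change of quaternionic frame whose first row is (a, b). *)
Definition proj_mx (v : 'I_4 -> quat2 R) (a b : H) : 'M[R]_4 :=
  quat_mx (fun p => a * (v p).1 + b * (v p).2).

Lemma proj_mxDZ v a b c d t :
  proj_mx v (a + t *: c) (b + t *: d) = proj_mx v a b + t *: proj_mx v c d.
Proof.
rewrite -quat_mxZ -quat_mxD; apply: eq_quat_mx => p.
by rewrite !mulrDl -!scalerAl scalerDr addrACA.
Qed.

Lemma proj_mxZ v a b t : proj_mx v (t *: a) (t *: b) = t *: proj_mx v a b.
Proof.
by rewrite -quat_mxZ; apply: eq_quat_mx => p; rewrite -!scalerAl scalerDr.
Qed.

(** A 4-plane is the graph of a map over some quaternionic line: a kernel
    vector (x, y) of a projection which is not invertible is sent by the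
    variations (c, d) of the line to all the c x + d y, that is to all of H, so
    the rank can still grow. *)
Lemma exists_proj_unit (v : 'I_4 -> quat2 R) : orthonormal v ->
  exists a b, \det (proj_mx v a b) != 0.
Proof.
move=> ov.
have grow a b : (\rank (proj_mx v a b) < 4)%N ->
    exists a' b', (\rank (proj_mx v a b) < \rank (proj_mx v a' b'))%N.
  set W := proj_mx v a b => rW.
  have [|u /sub_kermxP uW u0] := @rowV0Pn _ _ _ (kermx W) _.
    by rewrite kermx_eq0 /row_free neq_ltn rW.
  have [|i Wi] := @row_subPn _ _ _ _ (1%:M : 'M[R]_4) W _.
    apply: contraL rW => /mxrankS; rewrite mxrank1 -leqNgt.
    exact.
  pose x := \sum_p u ord0 p *: (v p).1; pose y := \sum_p u ord0 p *: (v p).2.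
  have uP c d j : (u *m proj_mx v c d) ord0 j = qcoef (c * x + d * y) j.
    rewrite mxE qcoefD !mulr_sumr !qcoef_sum -big_split; apply: eq_bigr => p _ /=.
    by rewrite mxE -!scalerAr qcoefD !qcoefZ mulrDr.
  have [c [d cd]] : exists c d, c * x + d * y = unit_of R i.
    have [x0|x0] := eqVneq x 0; last first.
      by exists (unit_of R i * qinv x), 0; rewrite -mulrA qinvV // mulr1 mul0r addr0.
    have [y0|y0] := eqVneq y 0; last first.
      by exists 0, (unit_of R i * qinv y); rewrite -mulrA qinvV // mulr1 mul0r add0r.
    case/eqP: u0; apply/rowP => p; rewrite [RHS]mxE.
    rewrite -(orthonormal_coef (u ord0) p ov).
    suff -> : \sum_r u ord0 r *: v r = 0 by rewrite hprod0r.
    rewrite [LHS]surjective_pairing (raddf_sum fst) (raddf_sum snd).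
    by congr pair; [rewrite -[RHS]x0|rewrite -[RHS]y0]; apply: eq_bigr.
  have [||t tP] := @rank_perturb _ _ _ W (proj_mx v c d) u => //.
    have -> : u *m proj_mx v c d = row i 1%:M; last by [].
    by apply/rowP => j; rewrite uP cd qcoef_unit !mxE.
  by exists (a + t *: c), (b + t *: d); rewrite proj_mxDZ.
have reach_rank n : (n <= 4)%N -> exists a b, (n <= \rank (proj_mx v a b))%N.
  elim: n => [|n IHn] hn; first by exists 0, 0.
  have [a [b ab]] := IHn (ltnW hn).
  have [r4|r4] := ltnP (\rank (proj_mx v a b)) 4; last first.
    by exists a, b; apply: leq_trans r4.
  have [a' [b' ab']] := grow _ _ r4.
  by exists a', b'; apply: leq_ltn_trans ab'.
have [a [b ab]] := reach_rank 4%N (leqnn _).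
exists a, b; rewrite -unitfE -unitmxE -row_free_unit /row_free eqn_leq ab.
by rewrite rank_leq_row.
Qed.

End FourPlanes.

Section FourPlanesNormalForm.
Variable R : realType.
Local Notation H := (quat R).

Lemma cts_qcoef_l_mul (x y : H) i :
  rvcts (fun v => qcoef (lquat v * x + rquat v * y) i).
Proof.
by elim/ord4_ind: i; under eq_fun do rewrite /qcoef /= ?inordK //=; cts.
Qed.

(** By compactness there is a best unit row (a, b); the determinant being
    homogeneous of degree 4, it then bounds all the other ones. *)
Lemma exists_max_proj (v : 'I_4 -> quat2 R) : exists a b,
  qnormsq a + qnormsq b = 1 /\ forall c d,
    \det (proj_mx v c d) ^+ 2 <=
    (qnormsq c + qnormsq d) ^+ 4 * \det (proj_mx v a b) ^+ 2.
Proof.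
pose A : set 'rV[R]_8 := [set v | qnormsq (lquat v) + qnormsq (rquat v) = 1]%classic.
have [||||s As smax] := @max_on_bounded_closed R 8 A
    (fun s => \det (proj_mx v (lquat s) (rquat s)) ^+ 2).
- exists (row_of_quats 1 0); rewrite /A /= lquat_row rquat_row qnormsq1.
  by rewrite (_ : qnormsq 0 = 0) ?addr0 //; apply/eqP; rewrite qnormsq_eq0.
- apply: closed_level; apply: ctsD; [exact: cts_qnormsq_l|exact: cts_qnormsq_r].
- move=> s /= As; apply: row_coord_le1; rewrite -As;
  by rewrite ?lerDl ?lerDr qnormsq_ge0.
- apply: rvctsP; rewrite (_ : (fun s => _ ^+ 2) = fun s =>
    \det (proj_mx v (lquat s) (rquat s)) * \det (proj_mx v (lquat s) (rquat s))).
    apply: ctsM; apply: cts_det => i j.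
      have -> : (fun s => proj_mx v (lquat s) (rquat s) i j) =
        fun s => qcoef (lquat s * (v i).1 + rquat s * (v i).2) j.
        by apply/funext => s; rewrite mxE.
      exact: cts_qcoef_l_mul.
    have -> : (fun s => proj_mx v (lquat s) (rquat s) i j) =
        fun s => qcoef (lquat s * (v i).1 + rquat s * (v i).2) j.
      by apply/funext => s; rewrite mxE.
    exact: cts_qcoef_l_mul.
  by apply/funext => s; rewrite expr2.
exists (lquat s), (rquat s); split=> // c d.
pose n := qnormsq c + qnormsq d.
have n_ge0 : 0 <= n by rewrite addr_ge0 ?qnormsq_ge0.
have [n0|n0] := eqVneq n 0.
  move/eqP: (n0); rewrite paddr_eq0 ?qnormsq_ge0 // !qnormsq_eq0 => /andP[/eqP c0 /eqP d0].
  rewrite -/n n0 expr0n mul0r (_ : proj_mx v c d = 0) ?det0 ?expr0n //.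
  by rewrite c0 d0 -[X in proj_mx v X X](scale0r 0) proj_mxZ scale0r.
pose r := Num.sqrt n; have r2 : r ^+ 2 = n by rewrite sqr_sqrtr.
have r0 : r != 0 by rewrite -sqrf_eq0 r2.
have := smax (row_of_quats (r^-1 *: c) (r^-1 *: d)).
rewrite lquat_row rquat_row proj_mxZ detZ exprMn -exprM => h.
have -> : n ^+ 4 = r ^+ 8 by rewrite -r2 -exprM.
rewrite -ler_pdivrMl ?exprn_even_gt0 // -exprVn; apply: h.
by rewrite /A /= lquat_row rquat_row !qnormsqZ -mulrDr exprVn r2 mulVf.
Qed.

Lemma row_combination_norm (a b a0 b0 c0 d0 : H) :
  qnormsq a0 + qnormsq b0 = 1 -> c0 * qconj a0 + d0 * qconj b0 = 0 ->
  qnormsq c0 + qnormsq d0 = 1 ->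
  qnormsq (a * a0 + b * c0) + qnormsq (a * b0 + b * d0) = qnormsq a + qnormsq b.
Proof.
move=> r1 r12 r2.
transitivity (qnormsq a * (qnormsq a0 + qnormsq b0) +
  qnormsq b * (qnormsq c0 + qnormsq d0) +
  2 * q0 (b * (c0 * qconj a0 + d0 * qconj b0) * qconj a)).
  by rewrite /qnormsq /=; ring.
by rewrite r1 r2 r12 mulr0 mul0r /= mulr0 addr0 !mulr1.
Qed.

(** In the quaternionic frame that maximises the projection, the projection is
    invertible, and the basis of the plane is chosen so that it becomes the
    identity: the plane is then the graph of the map sending the units
    1, i, j, k to the quaternions y_p. *)
Lemma exists_critical_graph (v : 'I_4 -> quat2 R) : orthonormal v ->
  exists y : 'I_4 -> H,
    reach (fspan v) (fspan (fun p : 'I_4 => (unit_of R p, y p))) /\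
    forall a b, \det (quat_mx (fun p : 'I_4 => a * unit_of R p + b * y p)) ^+ 2
                <= (qnormsq a + qnormsq b) ^+ 4.
Proof.
move=> ov; have [a0 [b0 [n0 max]]] := exists_max_proj v.
have [a1 [b1 d1]] := exists_proj_unit ov.
have [c0 [d0 [sA r12 n2]]] := Sp2_complete n0.
pose X := proj_mx v a0 b0.
have dX : \det X != 0.
  apply: contra d1 => /eqP X0; have := max a1 b1.
  rewrite -/X X0 expr0n mulr0 => h.
  by rewrite -sqrf_eq0 eq_le h sqr_ge0.
have uX : X \in unitmx by rewrite unitmxE unitfE.
pose v' p := lmult (qmx2 a0 b0 c0 d0) (v p).
pose w p := \sum_r invmx X p r *: v' r.
have wE a b p : a * (w p).1 + b * (w p).2 = \sum_r invmx X p r *: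
    ((a * a0 + b * c0) * (v r).1 + (a * b0 + b * d0) * (v r).2).
  rewrite /w (raddf_sum fst) (raddf_sum snd) !mulr_sumr -big_split.
  apply: eq_bigr => r _; rewrite /v' lmult_qmx2 /= -!scalerAr -scalerDr.
  congr (_ *: _); rewrite !mulrDr !mulrDl !mulrA; exact: addrACA.
have wX a b : quat_mx (fun p => a * (w p).1 + b * (w p).2) =
    invmx X *m proj_mx v (a * a0 + b * c0) (a * b0 + b * d0).
  by rewrite -quat_mx_comb; apply: eq_quat_mx => p; rewrite wE.
have w1 p : (w p).1 = unit_of R p.
  have := wX 1 0; rewrite !mul1r !mul0r !addr0 mulVmx // -quat_mx_unit => /matrixP e.
  apply: qcoef_inj => i; have := e p i; rewrite !mxE => <-.
  by rewrite mul1r mul0r addr0.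
exists (fun p => (w p).2); split.
  have -> : fspan (fun p : 'I_4 => (unit_of R p, (w p).2)) = fspan v'.
    rewrite -(@fspan_mul _ _ v' w (invmx X)) ?unitmx_inv //.
    by apply: eq_fspan => p; rewrite -w1 -surjective_pairing.
  exact: reach_lmult.
move=> a b.
have -> : quat_mx (fun p : 'I_4 => a * unit_of R p + b * (w p).2) =
    invmx X *m proj_mx v (a * a0 + b * c0) (a * b0 + b * d0).
  by rewrite -wX; apply: eq_quat_mx => p; rewrite w1.
rewrite det_mulmx det_inv exprMn mulrC exprVn ler_pdivrMr ?exprn_even_gt0 //.
apply: le_trans (max _ _) _.
by rewrite (row_combination_norm _ _ n0 r12 n2).
Qed.

(** At the maximum the first variation vanishes: for every h, the trace of
    x |-> h Z(x) is zero, where Z is the map whose graph is the plane. This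
    trace is the real part of h S, with S the sum in the conclusion. *)
Lemma critical_graph_trace (y : 'I_4 -> H) :
  (forall a b, \det (quat_mx (fun p : 'I_4 => a * unit_of R p + b * y p)) ^+ 2
     <= (qnormsq a + qnormsq b) ^+ 4) ->
  \sum_(p < 4) y p * qconj (unit_of R p) = 0.
Proof.
move=> max; set S := \sum_(p < 4) _.
suff : q0 (qconj S * S) = 0.
  by rewrite qconj_mul q0Z mulr1 => /eqP; rewrite qnormsq_eq0 => /eqP.
set h := qconj S.
(* expand the bound at (1, t h) to first order in t *)
have -> : q0 (h * S) = \tr (quat_mx (fun p => h * y p)).
  rewrite /mxtrace /S !sum4E !mxE /qcoef /= !inordK //=; ring.
have [P [P0 P1 PE]] := det_1p_poly (quat_mx (fun p => h * y p)).
rewrite -P1.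
pose G : {poly R} := (1 + (qnormsq h) *: 'X^2) ^+ 4 - P ^+ 2.
have G0 t : 0 <= G.[t].
  rewrite /G hornerD hornerN !horner_exp hornerD hornerZ hornerXn hornerC -PE.
  rewrite subr_ge0; have := max 1 (t *: h).
  rewrite qnormsq1 qnormsqZ [t ^+ 2 * _]mulrC.
  suff -> : quat_mx (fun p : 'I_4 => 1 * unit_of R p + t *: h * y p) =
    1%:M + t *: quat_mx (fun p => h * y p) by [].
  rewrite -quat_mx_unit -quat_mxZ -quat_mxD.
  by apply: eq_quat_mx => p; rewrite mul1r -scalerAl.
have P_0 : P.[0] = 1 by rewrite horner_coef0.
have P_1 : (deriv P).[0] = P`_1 by rewrite horner_coef0 coef_deriv.
have : G`_1 = 0.
  apply: (poly_nonneg_coef1 G0); rewrite -horner_coef0 !hornerE /= P_0; ring.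
have -> : G`_1 = (deriv G).[0] by rewrite horner_coef0 coef_deriv.
rewrite /G !exprS !expr0 !mulr1 derivB !(derivM, derivD, derivZ, derivX, derivC) !hornerE /= P_0 P_1 => e.
by move: e; lra.
Qed.
End FourPlanesNormalForm.

Section Graph.
Variable R : realType.
Local Notation H := (quat R).

Local Notation iu b := (unit_of R (nat_of_ord b).+1).

Definition sandwich (z : 'I_3 -> H) (x : H) : H := \sum_b z b * x * iu b.

Definition sandwich_graph (z : 'I_3 -> H) : {vspace quat2 R} :=
  fspan (fun p : 'I_4 => (unit_of R p, sandwich z (unit_of R p))).

Lemma sum_units (w : H) : \sum_(b < 3) iu b * w * iu b = w - (4 * q0 w)%:A.
Proof. by rewrite sum3E /= !inordK //; apply: quat_ext => /=; ring. Qed.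

(** A real-linear map of H is a sum of maps x |-> z x b over b = 1, i, j, k,
    and the coefficient of b = 1 is a quarter of the sum which vanishes here;
    the others are found by averaging over the units in the same way. *)
Lemma traceless_sandwich (y : 'I_4 -> H) :
  \sum_(p < 4) y p * qconj (unit_of R p) = 0 ->
  exists z, forall p : 'I_4, y p = sandwich z (unit_of R p).
Proof.
move=> y0.
exists (fun b => (- 4^-1) *: \sum_(p < 4) y p * iu b * qconj (unit_of R p)) => p.
have -> : sandwich (fun b => (- 4^-1) *: \sum_(p < 4) y p * iu b * qconj (unit_of R p))
    (unit_of R p) = (- 4^-1) *:
    \sum_(b < 3) (\sum_(s < 4) y s * iu b * qconj (unit_of R s)) * unit_of R p * iu b.
  by rewrite /sandwich scaler_sumr; apply: eq_bigr => b _; rewrite -!scalerAl.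
suff -> : \sum_(b < 3) (\sum_(s < 4) y s * iu b * qconj (unit_of R s)) * unit_of R p * iu b
    = - 4 *: y p + (\sum_(s < 4) y s * qconj (unit_of R s)) * unit_of R p.
  by rewrite y0 mul0r addr0 scalerA mulrNN mulVf ?scale1r // pnatr_eq0.
rewrite mulr_suml.
under eq_bigr do rewrite !mulr_suml.
rewrite exchange_big /=.
have E (s : 'I_4) : \sum_(b < 3) y s * iu b * qconj (unit_of R s) * unit_of R p * iu b =
    y s * qconj (unit_of R s) * unit_of R p - (4 * (s == p)%:R) *: y s.
  rewrite -qcoef_unit -mulrA -[4 * _](_ : 4 * q0 (qconj (unit_of R s) * unit_of R p) = _).
    rewrite -[X in _ - X]mulr1 -scalerAl scalerAr -mulrBr -sum_units mulr_sumr.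
    by apply: eq_bigr => b _; rewrite !mulrA.
  by elim/ord4_ind: s; elim/ord4_ind: p; rewrite /qcoef /= ?inordK //=; ring.
under eq_bigr do rewrite E.
rewrite sumrB addrC; congr (_ + _); rewrite (bigD1 p) //= eqxx mulr1 big1 ?addr0 ?scaleNr //.
by move=> s /negPf ->; rewrite mulr0 scale0r.
Qed.

Lemma sandwichD z x y : sandwich z (x + y) = sandwich z x + sandwich z y.
Proof.
by rewrite /sandwich -big_split; apply: eq_bigr => b _ /=; rewrite mulrDr mulrDl.
Qed.

Lemma sandwichZ z a x : sandwich z (a *: x) = a *: sandwich z x.
Proof.
by rewrite /sandwich scaler_sumr; apply: eq_bigr => b _; rewrite -scalerAr -scalerAl.
Qed.

Lemma sandwich_sum z (f : 'I_4 -> H) :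
  sandwich z (\sum_r f r) = \sum_r sandwich z (f r).
Proof.
apply: (big_morph (sandwich z)) => [x y|]; first exact: sandwichD.
by rewrite -(scale0r (0 : H)) sandwichZ !scale0r.
Qed.

Lemma conj_iu (q : H) (b : 'I_3) :
  qconj q * iu b * q = \sum_(c < 3) qrot q b c *: iu c.
Proof.
rewrite sum3E !mxE !inordK //.
by elim/ord3_ind: b; rewrite /= ?inordK //=; apply: quat_ext => /=; ring.
Qed.

(** The residual symmetries of a graph: left multiplications on the two
    coordinates and a right multiplication, which rotates i, j, k. *)
Lemma reach_sandwich_graph (z : 'I_3 -> H) (p p' q : H) :
  qnormsq p = 1 -> qnormsq p' = 1 -> qnormsq q = 1 ->
  reach (sandwich_graph z) (sandwich_graph
    (fun c => \sum_b qrot q b c *: (p' * z b * qconj p))).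
Proof.
move=> p1 p'1 q1; pose Z := sandwich z.
apply: reach_trans (reach_lmult _ (Sp2_diag p1 p'1)) _.
apply: reach_trans (reach_rmult _ q1) _.
set v := (fun r : 'I_4 => rmult q _).
have vE r : v r = (p * unit_of R r * q, p' * Z (unit_of R r) * q).
  by rewrite /v lmult_qmx2 !mul0r addr0 add0r.
pose A := quat_mx (fun e : 'I_4 => qconj p * unit_of R e * qconj q).
have comb x : \sum_(r < 4) qcoef x r *: (p * unit_of R r * q) = p * x * q.
  rewrite [in RHS](qcoefE x) mulr_sumr mulr_suml; apply: eq_bigr => r _.
  by rewrite -scalerAr -scalerAl.
have combZ x : \sum_(r < 4) qcoef x r *: (p' * Z (unit_of R r) * q) = p' * Z x * q.
  rewrite /Z [in RHS](qcoefE x) sandwich_sum mulr_sumr mulr_suml; apply: eq_bigr => r _.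
  by rewrite sandwichZ -scalerAr -scalerAl.
have pKq x : p * (qconj p * x * qconj q) * q = x.
  by rewrite !mulrA mul_unit_qconj // mul1r -mulrA qconj_unit_mul // mulr1.
have uA : A \in unitmx.
  have [] // := @mulmx1_unit _ _ A (quat_mx (fun r : 'I_4 => p * unit_of R r * q)).
  rewrite -quat_mx_comb -quat_mx_unit; apply: eq_quat_mx => e.
  by under eq_bigr do rewrite mxE; rewrite comb pKq.
exists \1%VF; first exact: Sp2Sp1_id.
rewrite lim1g; apply/esym; apply: (fspan_mul uA) => e.
under eq_bigr do rewrite mxE vE.
rewrite [RHS]surjective_pairing (raddf_sum fst) (raddf_sum snd) /= comb combZ pKq.
congr pair.
rewrite /Z /sandwich mulr_sumr mulr_suml.
transitivity (\sum_(b < 3) p' * z b * qconj p * unit_of R e * (qconj q * iu b * q)).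
  under [RHS]eq_bigr do rewrite conj_iu mulr_sumr.
  rewrite exchange_big; apply: eq_bigr => c _; rewrite !mulr_suml.
  by apply: eq_bigr => b _; rewrite -!scalerAl -scalerAr.
by apply: eq_bigr => b _; rewrite !mulrA.
Qed.

Lemma q0_conj_mul (x y : H) : q0 (qconj x * y) = \sum_i qcoef x i * qcoef y i.
Proof. by rewrite sum4E /qcoef /= !inordK //=; ring. Qed.

(** Three real linear equations in four unknowns. *)
Lemma exists_unit_orthogonal (z : 'I_3 -> H) :
  exists2 e, qnormsq e = 1 & forall b, q0 (qconj e * z b) = 0.
Proof.
pose M : 'M[R]_(4, 3) := \matrix_(i, b) qcoef (z b) i.
have [|u /sub_kermxP uM u0] := @rowV0Pn _ _ _ (kermx M) _.
  by rewrite kermx_eq0 /row_free neq_ltn (leq_ltn_trans (rank_leq_col M)).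
pose e := \sum_(i < 4) u ord0 i *: unit_of R i.
have eE i : qcoef e i = u ord0 i.
  rewrite qcoef_sum (bigD1 i) //= qcoefZ qcoef_unit eqxx mulr1 big1 ?addr0 //.
  by move=> r /negPf ri; rewrite qcoefZ qcoef_unit ri mulr0.
have e0 : e != 0.
  apply: contra u0 => /eqP e0; apply/eqP/rowP => i.
  by rewrite -eE e0 !mxE -(scale0r (0 : H)) qcoefZ mul0r.
exists (qunit e); first exact: qnormsq_unit.
move=> b; rewrite /qunit qconjZ -scalerAl q0Z q0_conj_mul.
have S : \sum_i qcoef e i * qcoef (z b) i = (u *m M) ord0 b.
  by rewrite mxE; apply: eq_bigr => i _; rewrite eE mxE.
by rewrite S uM mxE mulr0.
Qed.

Lemma qim_conjugate_l (p x : H) a :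
  qim (p * x * qconj p) a = \sum_b qrot p a b * qim x b.
Proof.
rewrite -{1}[p]qconjK qim_conjugate; apply: eq_bigr => b _.
by rewrite -tr_qrot mxE.
Qed.

Definition diag_coef (t : 'I_3 -> R) (r : 'I_4) : R :=
  [:: - t ord0 - t (inord 1) - t (inord 2); - t ord0 + t (inord 1) + t (inord 2);
      t ord0 - t (inord 1) + t (inord 2); t ord0 + t (inord 1) - t (inord 2)]`_r.

Lemma sandwich_diag (t : 'I_3 -> R) (r : 'I_4) :
  sandwich (fun c => t c *: iu c) (unit_of R r) = diag_coef t r *: unit_of R r.
Proof.
rewrite /sandwich sum3E /diag_coef; move: (t ord0) (t (inord 1)) (t (inord 2)).
move=> a b c; rewrite !inordK //.
by elim/ord4_ind: r; rewrite /= ?inordK //=; apply: quat_ext => /=; ring.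
Qed.

(** The residual symmetries diagonalise the map whose graph is the plane: a
    left factor makes its three coefficients imaginary, and they then form a
    3 x 3 real matrix, which two rotations diagonalise. A map
    x |-> sum_b t_b b x b is diagonal on 1, i, j, k, and the graph of a diagonal
    map is spanned by real multiples of the units. *)
Lemma normalizable4 (v : 'I_4 -> quat2 R) : orthonormal v -> normalizable 4 (fspan v).
Proof.
move=> /exists_critical_graph[y [vy /critical_graph_trace/traceless_sandwich[z yz]]].
have [e e1 ez] := exists_unit_orthogonal z.
pose T : 'M[R]_3 := \matrix_(a, b) qim (qconj e * z b) a.
have [p [q [p1 q1 diag]]] := rotation_svd T.
pose z' c := \sum_b qrot q b c *: (p * qconj e * z b * qconj p).
have z'E (c : 'I_3) : z' c = qim (z' c) c *: iu c.
  apply: imaginary_unit => [|a /diag <-].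
    rewrite q0_sum big1 // => b _; rewrite q0Z.
    have -> : p * qconj e * z b * qconj p =
      qconj (qconj p) * (qconj e * z b) * qconj p by rewrite qconjK !mulrA.
    by rewrite q0_conjugate ez !mulr0.
  rewrite qim_sum [RHS]mxE; apply: eq_bigr => b _.
  rewrite qimZ mulrC -[_ * z b](mulrA p) qim_conjugate_l; congr (_ * _).
  rewrite [RHS]mxE.
  by apply: eq_bigr => d _; rewrite [T _ _]mxE.
pose t c := qim (z' c) c.
pose d (r : 'I_4) : R := diag_coef t r.
apply: (@normalizable_real _ _ _ (fun=> 1) d) => [r|].
  by rewrite expr1n paddr_eq0 ?sqr_ge0 // oner_eq0.
apply: reach_trans vy _.
rewrite (@eq_fspan _ _ _ (fun r : 'I_4 => (unit_of R r, sandwich z (unit_of R r)))); last first.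
  by move=> r; rewrite yz.
have p'1 : qnormsq (p * qconj e) = 1 by rewrite qnormsqM qnormsq_conj p1 e1 mulr1.
have := reach_sandwich_graph z p1 p'1 q1.
congr reach; apply: eq_fspan => r; rewrite -/z' /rmult /=.
congr pair; first by rewrite scale1r mul1r.
rewrite -scalerAl mul1r -(sandwich_diag t).
by apply: eq_bigr => b _; rewrite z'E.
Qed.

End Graph.

(** * Admissibility of the parameters of a normal form *)

Section Admissible.
Variable R : realType.
Local Notation H := (quat R).

Lemma coefE k (lam : param R k) (p q : 'I_k) (h : (p < q)%N) :
  coef lam p q = lam (exist _ (p, q) h).
Proof.
by rewrite /coef (@insubT _ (fun pq : 'I_k * 'I_k => (pq.1 < pq.2)%N) _ (p, q) h).
Qed.

Lemma coef_sym k (lam : param R k) (p q : 'I_k) : coef lam p q = coef lam q p.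
Proof.
rewrite /coef; case: insubP => [e /= pq _|/= pq]; case: insubP => [f /= qp _|/= qp] //.
- by have := ltn_trans pq qp; rewrite ltnn.
Qed.

Lemma moore_rank_factor k r (M : 'M[H]_k) (B : 'M[H]_(k, r)) (V : 'M[H]_(r, k)) :
  M = B *m V -> (forall c : 'cV[H]_r, B *m c = 0 -> c = 0) ->
  (forall c : 'cV[H]_r, exists x, V *m x = c) -> moore_rank M r.
Proof.
move=> ME Binj Vsurj; exists B; split=> //; apply/seteqP; split=> y /=.
  by move=> [x _ <-]; exists (V *m x) => //; rewrite ME mulmxA.
by move=> [c _ <-]; have [x <-] := Vsurj c; exists x => //; rewrite ME mulmxA.
Qed.

Definition cos_param k (theta : 'I_k -> R) : param R k :=
  [ffun e => cos (theta (val e).1 - theta (val e).2)].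

Lemma coef_cos_param k (theta : 'I_k -> R) (p q : 'I_k) : (p < q)%N ->
  coef (cos_param theta) p q = cos (theta p - theta q).
Proof. by move=> pq; rewrite (coefE _ pq) ffunE. Qed.

Lemma upper_unitE p q : (p < q < 4)%N ->
  upper_unit R p q = qconj (unit_of R p) * unit_of R q.
Proof.
case: p q => [|[|[|p]]] [|[|[|[|q]]]] //=; rewrite ?andbF //;
  by move=> _; apply: quat_ext => /=; ring.
Qed.

Lemma hprod_theta_vec k (theta : 'I_k -> R) p q :
  hprod (theta_vec theta p) (theta_vec theta q) =
  cos (theta p - theta q) *: (qconj (unit_of R p) * unit_of R q).
Proof.
by rewrite cosB /hprod /theta_vec /=; apply: quat_ext => /=; ring.
Qed.

Lemma Mmx_cos_param k (theta : 'I_k -> R) : (k <= 4)%N -> forall p q,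
  Mmx (cos_param theta) p q = hprod (theta_vec theta p) (theta_vec theta q).
Proof.
move=> k4 p q; rewrite mxE hprod_theta_vec.
have up (i j : 'I_k) : (i < j)%N ->
    upper_unit R i j = qconj (unit_of R i) * unit_of R j.
  by move=> ij; apply: upper_unitE; rewrite ij (leq_trans (ltn_ord j)).
case: ltngtP => [pq|qp|/val_inj ->].
- by rewrite coef_cos_param // up.
- by rewrite coef_cos_param // up // qconjZ qconjM qconjK -cosN opprB.
- by rewrite subrr cos0 scale1r qconj_mul qnormsq_unit_of scale1r.
Qed.

(** M_lambda is V^* V for the matrix V with two rows whose columns are the
    vectors of the normal form. When two of the angles differ modulo pi, V^* is
    injective and V surjective, and the rank is 2; otherwise all the columns are
    proportional to the first one and the rank is 1. *)
Lemma admissible_cos_param k (theta : 'I_k.+1 -> R) : (k < 4)%N ->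
  admissible (cos_param theta).
Proof.
move=> k4; split=> [e|]; first by rewrite ffunE cos_geN1 cos_le1.
have ME p q := Mmx_cos_param theta k4 p q.
have [[p [q pq]]|par] := pselect (exists p q, sin (theta p - theta q) != 0).
- exists 2%N => //.
  pose f (j : 'I_2) p : R := if j == ord0 then cos (theta p) else sin (theta p).
  have sum2 (F : 'I_2 -> H) : \sum_j F j = F ord0 + F ord_max.
    by rewrite !big_ord_recr big_ord0 /= add0r; congr (F _ + F _); apply/val_inj.
  apply: (@moore_rank_factor _ 2 _ (\matrix_(p, j) (f j p *: qconj (unit_of R p)))
                               (\matrix_(j, p) (f j p *: unit_of R p))).
  + apply/matrixP => r s; rewrite ME hprod_theta_vec mxE sum2 !mxE /f /= cosB.
    by apply: quat_ext => /=; ring.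
  + move=> c /colP Bc.
    have Bc' r : cos (theta r) *: c ord0 ord0 + sin (theta r) *: c ord_max ord0 = 0.
      apply: (@qmulf_eq0 _ (qconj (unit_of R r))).
        have := Bc r; rewrite !mxE sum2 !mxE /f /= => <-.
        by rewrite mulrDr -!scalerAr -!scalerAl.
      by rewrite -qnormsq_eq0 qnormsq_conj qnormsq_unit_of oner_neq0.
    have sp : sin (theta p - theta q) =
      sin (theta p) * cos (theta q) - cos (theta p) * sin (theta q) by exact: sinB.
    have c0 : sin (theta p - theta q) *: c ord0 ord0 = 0.
      transitivity (sin (theta p) *: 0 - sin (theta q) *: 0 : H).
        by rewrite -{1}(Bc' q) -(Bc' p) sp; apply: quat_ext => /=; ring.
      by rewrite !scaler0 subrr.
    have c1 : sin (theta p - theta q) *: c ord_max ord0 = 0.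
      transitivity (cos (theta q) *: 0 - cos (theta p) *: 0 : H).
        by rewrite -{1}(Bc' p) -(Bc' q) sp; apply: quat_ext => /=; ring.
      by rewrite !scaler0 subrr.
    move/eqP: c0; rewrite scaler_eq0 (negPf pq) => /eqP c0.
    move/eqP: c1; rewrite scaler_eq0 (negPf pq) => /eqP c1.
    by apply/colP; elim/ord2_ind; rewrite [RHS]mxE.
  + move=> c; pose s := sin (theta p - theta q).
    pose al := s^-1 *: (cos (theta q) *: c ord_max ord0 - sin (theta q) *: c ord0 ord0).
    pose be := s^-1 *: (sin (theta p) *: c ord0 ord0 - cos (theta p) *: c ord_max ord0).
    exists (\col_r (if r == p then qconj (unit_of R p) * al
                    else if r == q then qconj (unit_of R q) * be else 0)).
    have qp : q != p by apply: contraNneq pq => ->; rewrite subrr sin0.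
    have sp : s = sin (theta p) * cos (theta q) - cos (theta p) * sin (theta q).
      exact: sinB.
    apply/colP => j; rewrite mxE (bigD1 p) //= (bigD1 q) //= big1 ?addr0; last first.
      by move=> r /andP[/negPf rp /negPf rq]; rewrite !mxE rp rq mulr0.
    rewrite !mxE !eqxx (negPf qp) -!scalerAl !mulrA !mul_qconj !qnormsq_unit_of.
    rewrite !scale1r !mul1r.
    elim/ord2_ind: j; rewrite /f /= /al /be; apply: quat_ext => /=;
      by rewrite [s]sp; field; rewrite -sp.
- exists 1%N => //.
  have sin0 p q : sin (theta p - theta q) = 0.
    by apply/eqP/negPn/negP => pq; apply: par; exists p, q.
  pose s p := cos (theta p - theta ord0).
  have cs p q : cos (theta p - theta q) = s p * s q.
    have -> : theta p - theta q = (theta p - theta ord0) - (theta q - theta ord0) by ring.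
    by rewrite cosB !sin0 mulr0 addr0.
  apply: (@moore_rank_factor _ 1 _ (\matrix_(p, j) (s p *: qconj (unit_of R p)))
                               (\matrix_(j, p) (s p *: unit_of R p))).
  + apply/matrixP => p q; rewrite ME hprod_theta_vec mxE big_ord1 !mxE cs.
    by rewrite -scalerAl -scalerAr scalerA.
  + move=> c /colP/(_ ord0); rewrite !mxE big_ord1 !mxE /s subrr cos0 scale1r => c0.
    apply/colP => j; rewrite ord1 [RHS]mxE -[RHS]c0.
    by apply: quat_ext => /=; ring.
  + move=> c; exists (\col_p (if p == ord0 then c ord0 ord0 else 0)).
    apply/colP => j; have -> : j = ord0 by exact: ord1.
    rewrite mxE (bigD1 ord0) //= big1 ?addr0.
      by rewrite !mxE eqxx /s subrr cos0 scale1r; apply: quat_ext => /=; ring.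
    by move=> p /negPf p0; rewrite !mxE p0 mulr0.
Qed.

End Admissible.

(** * Signed permutations of the parameters *)

Section Similarity.
Variable R : realType.
Local Notation H := (quat R).

(** A single sign change followed by a single permutation: the group generated
    by the two kinds of steps is a semidirect product, so that composites keep
    this form. *)
Definition sim k (f g : 'I_k -> 'I_k -> R) : Prop :=
  exists (eps : 'I_k -> bool) (s : 'S_k), forall p q, p != q ->
    g p q = (-1) ^+ eps p * (-1) ^+ eps q * f (s p) (s q).

Lemma sim_ext k (f g : 'I_k -> 'I_k -> R) :
  (forall p q, p != q -> g p q = f p q) -> sim f g.
Proof.
by move=> fg; exists (fun=> false), 1%g => p q pq; rewrite !perm1 fg // !mul1r.
Qed.

Lemma sim_perm k (f : 'I_k -> 'I_k -> R) (s : 'S_k) :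
  sim f (fun p q => f (s p) (s q)).
Proof. by exists (fun=> false), s => p q _; rewrite !mul1r. Qed.

Lemma sim_sign k (f : 'I_k -> 'I_k -> R) (eps : 'I_k -> bool) :
  sim f (fun p q => (-1) ^+ eps p * (-1) ^+ eps q * f p q).
Proof. by exists eps, 1%g => p q _; rewrite !perm1. Qed.

Lemma sim_trans k (g f h : 'I_k -> 'I_k -> R) : sim f g -> sim g h -> sim f h.
Proof.
move=> [e [s fg]] [e' [s' gh]].
exists (fun p => e' p (+) e (s' p)), (s' * s)%g => p q pq.
rewrite gh // fg ?(inj_eq perm_inj) // !permM !signr_addb; ring.
Qed.

(** The sign change conjugates M_lambda by a diagonal matrix D with D^2 = 1, so
    a basis B of the image is turned into the basis D B. *)
Lemma sign_adm k (lam : adm R k) (eps : 'I_k -> bool) : exists mu : adm R k,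
  forall p q, p != q ->
    coef (val mu) p q = (-1) ^+ eps p * (-1) ^+ eps q * coef (val lam) p q.
Proof.
pose m : param R k := [ffun e =>
  (-1) ^+ eps (val e).1 * (-1) ^+ eps (val e).2 * val lam e].
have mE p q : p != q -> coef m p q = (-1) ^+ eps p * (-1) ^+ eps q * coef (val lam) p q.
  have lt (i j : 'I_k) : (i < j)%N -> coef m i j = (-1) ^+ eps i * (-1) ^+ eps j * coef (val lam) i j.
    by move=> ij; rewrite !(coefE _ ij) ffunE.
  rewrite neq_ltn => /orP[/lt//|qp].
  by rewrite coef_sym lt // [X in X * _]mulrC [in RHS]coef_sym.
suff am : admissible m by exists (exist _ m (asboolT am)).
have /asboolP[lb [r r2 [B [Binj Bim]]]] := valP lam.
split=> [e|].
  rewrite ffunE -ler_norml !normrM !normr_sign !mul1r ler_norml; exact: lb.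
exists r => //.
pose D : 'M[H]_k := diag_mx (\row_i ((-1) ^+ eps i)%:A).
have DD : D *m D = 1%:M.
  apply/matrixP => i j; rewrite mul_diag_mx !mxE; case: eqVneq => [->|_].
    by rewrite !mulr1n -scalerAl mul1r scalerA -expr2 sqrr_sign scale1r.
  by rewrite !mulr0n mulr0.
have ME : Mmx m = D *m Mmx (val lam) *m D.
  apply/matrixP => i j; rewrite mul_mx_diag mul_diag_mx !mxE.
  case: ltngtP => [ij|ji|/val_inj ->].
  - by rewrite mE ?neq_ltn ?ij //; apply: quat_ext => /=; ring.
  - by rewrite mE ?neq_ltn ?ji ?orbT //; apply: quat_ext => /=; ring.
  - by rewrite mulr1 -scalerAl mul1r scalerA -expr2 sqrr_sign scale1r.
exists (D *m B); split=> [c|].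
  rewrite -mulmxA => /(congr1 (mulmx D)); rewrite mulmxA DD mul1mx mulmx0.
  exact: Binj.
apply/seteqP; split=> y /=.
  move=> [x _ <-]; have : [set B *m c | c in [set: 'cV[H]_r]]%classic (Mmx (val lam) *m (D *m x)).
    by rewrite -Bim; exists (D *m x).
  by move=> [c _ Bc]; exists c => //; rewrite ME -!mulmxA Bc.
move=> [c _ <-]; have : [set Mmx (val lam) *m x | x in [set: 'cV[H]_k]]%classic (B *m c).
  by rewrite Bim; exists c.
by move=> [x _ Mx]; exists (D *m x) => //; rewrite ME -!mulmxA (mulmxA D D) DD mul1mx Mx.
Qed.

(** Both steps must stay among admissible parameters: the intermediate one is
    admissible by [sign_adm]. *)
Lemma sim_adm_rel k (lam mu : adm R k) :
  sim (coef (val lam)) (coef (val mu)) -> adm_rel lam mu.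
Proof.
move=> [eps [s lm]].
have [nu nuE] := sign_adm lam (fun p => eps ((s^-1)%g p)).
apply/asboolP; apply: (@rst_trans _ _ _ nu).
  apply: rst_step; left; exists (fun p => eps ((s^-1)%g p)) => p q pq.
  by rewrite nuE // neq_ltn pq.
apply: rst_step; right; exists s => p q pq.
have pq' : p != q by rewrite neq_ltn pq.
by rewrite nuE ?(inj_eq perm_inj) // !permK lm.
Qed.

End Similarity.

(** * Two orthonormal frames of planes of the same orbit *)

Section Frames.
Variable R : realType.
Local Notation H := (quat R).

Lemma orthonormal_expand k (v : 'I_k -> quat2 R) x : orthonormal v ->
  x \in fspan v -> x = \sum_r q0 (hprod (v r) x) *: v r.
Proof.
move=> ov xv; have [c ->] : exists c : 'I_k -> R, x = \sum_r c r *: v r.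
  have xv' : x \in <<[tuple v p | p < k]>>%VS by [].
  exists (fun r => coord [tuple v p | p < k] r x).
  rewrite {1}(coord_span xv'); apply: eq_bigr => r _.
  by rewrite -tnth_nth tnth_mktuple.
by apply: eq_bigr => r _; rewrite orthonormal_coef.
Qed.

(** The image of the first frame and the second frame are orthonormal bases of
    the same plane, hence related by an orthogonal matrix; the Sp(2) factor is
    not seen by Gram matrices, and the Sp(1) factor rotates i, j, k. *)
Lemma gram_relation k (v w : 'I_k -> quat2 R) :
  orthonormal v -> orthonormal w -> reach (fspan v) (fspan w) ->
  exists (a : 'M[R]_k) (q : H), [/\ a *m a^T = 1%:M, qnormsq q = 1 &
    forall b, im_mx w b = \sum_c qrot q c b *: (a *m im_mx v c *m a^T)].
Proof.
move=> ov ow [g Gg gvw]; have [q [q1 gq]] := Sp2Sp1_hprod Gg.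
pose u p := g (v p).
have uw : fspan u = fspan w by rewrite -gvw limg_span -map_comp.
have hu r s : hprod (u r) (u s) = qconj q * hprod (v r) (v s) * q by exact: gq.
have ou : orthonormal u by rewrite /orthonormal (re_mx_conj q1 hu).
pose a : 'M[R]_k := \matrix_(p, r) q0 (hprod (u r) (w p)).
have wE p : w p = \sum_r a p r *: u r.
  rewrite {1}(orthonormal_expand ou (x := w p)) ?uw ?mem_fspan //.
  by apply: eq_bigr => r _; rewrite mxE.
exists a, q; split=> // [|b].
  by have := re_mx_mul wE; rewrite ow ou mulmx1.
rewrite (im_mx_mul b wE) (im_mx_conj b hu) mulmx_sumr mulmx_suml.
by apply: eq_bigr => c _; rewrite -scalemxAr -scalemxAl.
Qed.

End Frames.

(** * Invariants of triples of skew forms *)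

Section Invariants.
Variable R : realType.
Local Notation H := (quat R).

Definition linear1 (V : lmodType R) (h : V -> R) : Prop :=
  forall a X Y, h (a *: X + Y) = a * h X + h Y.

Lemma linear1_sum (V : lmodType R) (h : V -> R) (x : 'I_3 -> R) (K : 'I_3 -> V) :
  linear1 h -> h (\sum_c x c *: K c) = \sum_c x c * h (K c).
Proof.
move=> hl; have h0 : h 0 = 0 by have := hl (-1) 0 0; rewrite scaler0 addr0; lra.
elim/big_rec2: _ => // c y1 y2 _ <-; exact: hl.
Qed.

(** Some term of the Leibniz formula for the determinant is nonzero. *)
Lemma qrot_transversal (q : H) : qnormsq q = 1 ->
  exists s : 'S_3, forall b, qrot q (s b) b != 0.
Proof.
move=> q1; have [uq _] := mulmx1_unit (qrot_orthogonal q1).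
have dq : \det (qrot q)^T != 0 by rewrite det_tr -unitfE -unitmxE.
suff /existsP[s /forallP hs] : [exists s : 'S_3, [forall b, qrot q (s b) b != 0]].
  by exists s.
apply: contraNT dq => /existsPn ns; rewrite /determinant big1 // => s _.
have := ns s; rewrite negb_forall => /existsP[b]; rewrite negbK => /eqP qb.
by rewrite (bigD1 b) //= mxE qb mul0r mulr0.
Qed.

(** Rotating a family orthogonal for a symmetric bilinear form into another
    orthogonal family can only match vectors of the same square: both sides of
    the conclusion, times the entry of the rotation, compute the value of the
    form on the two matched vectors. *)
Lemma orthogonal_rotation (V : lmodType R) (f : V -> V -> R) (K L : 'I_3 -> V)
    (q : H) :
  qnormsq q = 1 -> (forall Y, linear1 (f^~ Y)) -> (forall X Y, f X Y = f Y X) ->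
  (forall b, L b = \sum_c qrot q c b *: K c) ->
  (forall c d, c != d -> f (K c) (K d) = 0) ->
  (forall c d, c != d -> f (L c) (L d) = 0) ->
  forall c b, qrot q c b != 0 -> f (L b) (L b) = f (K c) (K c).
Proof.
move=> q1 fl fs LE fK fL c b qcb; apply: (mulfI qcb).
have /matrixP rot := qrot_orthogonal q1.
have rot_sum d : \sum_b qrot q c b * qrot q d b = (c == d)%:R.
  have := rot c d; rewrite mxE [RHS]mxE => <-.
  by apply: eq_bigr => i _; rewrite [_^T _ _]mxE.
have KE : K c = \sum_b qrot q c b *: L b.
  under eq_bigr do rewrite LE scaler_sumr.
  rewrite exchange_big /= (bigD1 c) //= [X in _ + X]big1 ?addr0 => [|d dc].
    under eq_bigr do rewrite scalerA; rewrite -scaler_suml.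
    by rewrite rot_sum eqxx scale1r.
  under eq_bigr do rewrite scalerA; rewrite -scaler_suml.
  by rewrite rot_sum eq_sym (negPf dc) scale0r.
transitivity (f (L b) (K c)).
  rewrite fs KE (linear1_sum _ _ (fl _)) (bigD1 b) //= big1 ?addr0 // => d db.
  by rewrite fL ?mulr0.
rewrite LE (linear1_sum _ _ (fl _)) (bigD1 c) //= big1 ?addr0 // => d dc.
by rewrite fK ?mulr0.
Qed.

(** Expanding the rotated triple multiplies the value of an alternating
    trilinear form by the determinant of the rotation, which is 1. *)
Lemma alternating_rotation (V : lmodType R) (g : V -> V -> V -> R)
    (K L : 'I_3 -> V) (q : H) :
  qnormsq q = 1 ->
  (forall Y Z, linear1 (fun X => g X Y Z)) ->
  (forall X Z, linear1 (fun Y => g X Y Z)) ->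
  (forall X Y, linear1 (fun Z => g X Y Z)) ->
  (forall c d e, g (K d) (K e) (K c) = g (K c) (K d) (K e)) ->
  (forall c d e, g (K c) (K e) (K d) = - g (K c) (K d) (K e)) ->
  (forall b, L b = \sum_c qrot q c b *: K c) ->
  g (L ord0) (L (inord 1)) (L (inord 2)) =
  g (K ord0) (K (inord 1)) (K (inord 2)).
Proof.
move=> q1 g1 g2 g3 cyc anti LE.
have G0 c d : g (K c) (K d) (K d) = 0 by have := anti c d d; lra.
have G1 c d : g (K c) (K d) (K c) = 0 by rewrite cyc cyc G0.
have G2 c d : g (K c) (K c) (K d) = 0 by rewrite -cyc G1.
rewrite !LE (linear1_sum _ _ (g1 _ _)).
under eq_bigr => c _ do rewrite (linear1_sum _ _ (g2 _ _)).
under eq_bigr => c _ do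
  under eq_bigr => d _ do rewrite (linear1_sum _ _ (g3 _ _)).
rewrite !sum3E !(G0, G1, G2).
set x := g (K ord0) (K (inord 1)) (K (inord 2)).
have -> : g (K ord0) (K (inord 2)) (K (inord 1)) = - x by rewrite anti.
have -> : g (K (inord 1)) (K (inord 2)) (K ord0) = x by rewrite cyc.
have -> : g (K (inord 1)) (K ord0) (K (inord 2)) = - x by rewrite anti cyc.
have -> : g (K (inord 2)) (K ord0) (K (inord 1)) = x by rewrite cyc cyc.
have -> : g (K (inord 2)) (K (inord 1)) (K ord0) = - x by rewrite anti cyc cyc.
transitivity (qnormsq q ^+ 3 * x); last by rewrite q1 expr1n mul1r.
by rewrite !mxE /= !inordK //= /qnormsq; ring.
Qed.

Lemma tr_mul3_cyc n (X Y Z : 'M[R]_n) : \tr (Y *m Z *m X) = \tr (X *m Y *m Z).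
Proof. by rewrite mxtrace_mulC mulmxA. Qed.

Lemma tr_mul3_skew n (X Y Z : 'M[R]_n) : X^T = - X -> Y^T = - Y -> Z^T = - Z ->
  \tr (X *m Z *m Y) = - \tr (X *m Y *m Z).
Proof.
move=> sX sY sZ; rewrite -tr_mul3_cyc -mxtrace_tr !trmx_mul sX sY sZ.
by rewrite !mulNmx !mulmxN !opprK mulmxA raddfN mxtrace_mulC mulmxA -tr_mul3_cyc.
Qed.

(** The polarised Pfaffian of 4 x 4 skew matrices. *)
Definition pfaff (X Y : 'M[R]_4) : R :=
  X ord0 (inord 1) * Y (inord 2) (inord 3) + X (inord 2) (inord 3) * Y ord0 (inord 1)
  - X ord0 (inord 2) * Y (inord 1) (inord 3) - X (inord 1) (inord 3) * Y ord0 (inord 2)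
  + X ord0 (inord 3) * Y (inord 1) (inord 2) + X (inord 1) (inord 2) * Y ord0 (inord 3).

Lemma pfaff_sym X Y : pfaff X Y = pfaff Y X.
Proof. by rewrite /pfaff; ring. Qed.

Lemma pfaff_linear Y : linear1 (pfaff^~ Y).
Proof. by move=> a X X'; rewrite /pfaff !mxE; ring. Qed.

Lemma skew4 (X : 'M[R]_4) : X^T = - X ->
  (forall i, X i i = 0) /\
  [/\ X (inord 1) ord0 = - X ord0 (inord 1), X (inord 2) ord0 = - X ord0 (inord 2),
      X (inord 3) ord0 = - X ord0 (inord 3),
      X (inord 2) (inord 1) = - X (inord 1) (inord 2) &
      X (inord 3) (inord 1) = - X (inord 1) (inord 3) /\
      X (inord 3) (inord 2) = - X (inord 2) (inord 3)].
Proof.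
move=> /matrixP sX; have sk i j : X j i = - X i j by have := sX i j; rewrite !mxE.
by split=> [i|]; [have := sk i i; lra|by do ?split].
Qed.

(** The determinant, in its Laplace expansion along the first two rows, which
    is the form in which it appears in [pfaff_congruence]. *)
Definition det4 (A : 'M[R]_4) : R :=
  let m i j r s := A i r * A j s - A i s * A j r in
  let o1 := inord 1 in let o2 := inord 2 in let o3 := inord 3 in
  m ord0 o1 ord0 o1 * m o2 o3 o2 o3 - m ord0 o1 ord0 o2 * m o2 o3 o1 o3
  + m ord0 o1 ord0 o3 * m o2 o3 o1 o2 + m ord0 o1 o1 o2 * m o2 o3 ord0 o3
  - m ord0 o1 o1 o3 * m o2 o3 ord0 o2 + m ord0 o1 o2 o3 * m o2 o3 ord0 o1.

Lemma det4_tr A : det4 A^T = det4 A.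
Proof. by rewrite /det4 !mxE; ring. Qed.

Lemma skew_congruence (A X : 'M[R]_4) i j : X^T = - X ->
  let m r s := A i r * A j s - A i s * A j r in
  (A *m X *m A^T) i j =
  m ord0 (inord 1) * X ord0 (inord 1) + m ord0 (inord 2) * X ord0 (inord 2) +
  m ord0 (inord 3) * X ord0 (inord 3) + m (inord 1) (inord 2) * X (inord 1) (inord 2) +
  m (inord 1) (inord 3) * X (inord 1) (inord 3) +
  m (inord 2) (inord 3) * X (inord 2) (inord 3).
Proof.
move=> /skew4[d [e1 e2 e3 e4 [e5 e6]]] m; rewrite congruence_mxE !sum4E !d e1 e2 e3 e4 e5 e6.
by rewrite /m; ring.
Qed.

Lemma pfaff_congruence (A X Y : 'M[R]_4) : X^T = - X -> Y^T = - Y ->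
  pfaff (A *m X *m A^T) (A *m Y *m A^T) = det4 A * pfaff X Y.
Proof.
move=> sX sY; rewrite /pfaff !(skew_congruence _ _ _ sX) !(skew_congruence _ _ _ sY).
rewrite /det4 /=; ring.
Qed.

(** Moving a skew form of nonzero Pfaffian by A and then back by its transpose
    multiplies the Pfaffian by the square of the determinant. *)
Lemma det4_orthogonal (A : 'M[R]_4) : A *m A^T = 1%:M -> det4 A ^+ 2 = 1.
Proof.
move=> AA; have AA' := mulmx1C AA.
pose X : 'M[R]_4 := \matrix_(i, j)
  (((i, j) == (ord0, inord 1))%:R - ((i, j) == (inord 1, ord0))%:R
   + ((i, j) == (inord 2, inord 3))%:R - ((i, j) == (inord 3, inord 2))%:R).
have sX : X^T = - X.
  apply/matrixP => i j; rewrite !mxE !xpair_eqE.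
  by rewrite ![(j == _) && _]andbC; ring.
have XX : pfaff X X = 2.
  by rewrite /pfaff !mxE !xpair_eqE -!val_eqE /= !inordK //=; ring.
have sAX : (A *m X *m A^T)^T = - (A *m X *m A^T).
  by rewrite !trmx_mul trmxK sX mulNmx mulmxN mulmxA.
have := pfaff_congruence A^T sAX sAX; rewrite det4_tr (pfaff_congruence _ sX sX).
rewrite trmxK !mulmxA AA' mul1mx -!mulmxA AA' mulmx1 XX => e.
by move: e; rewrite expr2; lra.
Qed.

(** The Pfaffian pairing of a skew form with the commutator of two others:
    the alternating trilinear invariant which detects orientation reversals. *)
Definition pfaff3 (X Y Z : 'M[R]_4) : R := pfaff X (Y *m Z - Z *m Y).

Lemma pfaff3_linear1 Y Z : linear1 (fun X => pfaff3 X Y Z).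
Proof. exact: pfaff_linear. Qed.

Lemma pfaff3_linear2 X Z : linear1 (fun Y => pfaff3 X Y Z).
Proof.
move=> a Y Y'; rewrite /pfaff3 ![pfaff X _]pfaff_sym -pfaff_linear; congr (pfaff _ _).
by rewrite mulmxDl mulmxDr -scalemxAl -scalemxAr scalerBr opprD addrACA.
Qed.

Lemma pfaff3_anti X Y Z : pfaff3 X Z Y = - pfaff3 X Y Z.
Proof. by rewrite /pfaff3 /pfaff !mxE; ring. Qed.

Lemma pfaff3_linear3 X Y : linear1 (fun Z => pfaff3 X Y Z).
Proof.
by move=> a Z Z'; rewrite !(pfaff3_anti _ _ Y) pfaff3_linear2; ring.
Qed.

Lemma pfaff3_cyc X Y Z : X^T = - X -> Y^T = - Y -> Z^T = - Z ->
  pfaff3 Y Z X = pfaff3 X Y Z.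
Proof.
move=> /skew4[dx [x1 x2 x3 x4 [x5 x6]]] /skew4[dy [y1 y2 y3 y4 [y5 y6]]]
  /skew4[dz [z1 z2 z3 z4 [z5 z6]]].
have mE (A B : 'M[R]_4) i j : (A *m B - B *m A) i j =
    \sum_r (A i r * B r j) - \sum_r (B i r * A r j) by rewrite !mxE.
rewrite /pfaff3 /pfaff !mE !sum4E !(dx, dy, dz).
by rewrite !(x1, x2, x3, x4, x5, x6, y1, y2, y3, y4, y5, y6, z1, z2, z3, z4, z5, z6); ring.
Qed.

Lemma pfaff3_congruence (A X Y Z : 'M[R]_4) : A *m A^T = 1%:M ->
  X^T = - X -> Y^T = - Y -> Z^T = - Z ->
  pfaff3 (A *m X *m A^T) (A *m Y *m A^T) (A *m Z *m A^T) = det4 A * pfaff3 X Y Z.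
Proof.
move=> /mulmx1C AA sX sY sZ; rewrite /pfaff3 -pfaff_congruence //; last first.
  rewrite raddfB /= !trmx_mul sY sZ !mulNmx !mulmxN !opprK opprB.
  by [].
congr (pfaff _ _).
have M (U V : 'M[R]_4) : (A *m U *m A^T) *m (A *m V *m A^T) = A *m (U *m V) *m A^T.
  by rewrite -!mulmxA (mulmxA A^T A) AA mul1mx.
by rewrite !M mulmxBr mulmxBl.
Qed.

End Invariants.

(** * Invariants of the matrices M_lambda *)

Section ParameterInvariants.
Variable R : realType.
Local Notation H := (quat R).

Definition imM k (lam : param R k) (b : 'I_3) : 'M[R]_k :=
  \matrix_(r, s) qim (Mmx lam r s) b.

Lemma q0_upper_unit p q : q0 (upper_unit R p q) = 0.
Proof. by case: p q => [|[|[|p]]] [|[|[|[|q]]]]; rewrite /= ?oppr0. Qed.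

Lemma Mmx_re k (lam : param R k) p q : q0 (Mmx lam p q) = (p == q)%:R.
Proof.
rewrite mxE; case: ltngtP => [pq|qp|/val_inj ->].
- by rewrite q0Z q0_upper_unit mulr0 (ltn_eqF pq : (p == q) = false).
- by rewrite q0_conj q0Z q0_upper_unit mulr0 eq_sym (ltn_eqF qp : (q == p) = false).
- by rewrite eqxx.
Qed.

Lemma Mmx_gram k (lam : param R k) (v : 'I_k -> quat2 R) :
  (forall i j, hprod (v i) (v j) = Mmx lam i j) ->
  orthonormal v /\ forall b, im_mx v b = imM lam b.
Proof.
move=> hv; split; first by apply/orthonormalP => p q; rewrite hv Mmx_re.
by move=> b; apply/matrixP => r s; rewrite !mxE hv !mxE.
Qed.

Lemma imM_lt k (lam : param R k) b (p q : 'I_k) : (p < q)%N ->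
  imM lam b p q = coef lam p q * qim (upper_unit R p q) b.
Proof. by move=> pq; rewrite !mxE pq qimZ. Qed.

(** The relation between the coordinates of the Gram matrices of two frames of
    planes of the same orbit, which does not mention the frames any more. *)
Definition linked k (lam mu : param R k) (a : 'M[R]_k) (q : H) : Prop :=
  [/\ a *m a^T = 1%:M, qnormsq q = 1 &
   forall b, imM mu b = \sum_c qrot q c b *: (a *m imM lam c *m a^T)].

Lemma frames_linked k (lam mu : param R k) (v w : 'I_k -> quat2 R) :
  (forall i j, hprod (v i) (v j) = Mmx lam i j) ->
  (forall i j, hprod (w i) (w j) = Mmx mu i j) ->
  reach (fspan v) (fspan w) -> exists a q, linked lam mu a q.
Proof.
move=> /Mmx_gram[ov vE] /Mmx_gram[ow wE] vw.
have [a [q [aa q1 e]]] := gram_relation ov ow vw.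
exists a, q; split=> // b; rewrite -wE e; apply: eq_bigr => c _.
by rewrite vE.
Qed.

Lemma tr_imM k (lam : param R k) b : (imM lam b)^T = - imM lam b.
Proof.
apply/matrixP => r s; rewrite !mxE.
case: ltngtP => _; rewrite ?qim_conj ?opprK //.
by elim/ord3_ind: b; rewrite /qim /= ?inordK //= oppr0.
Qed.

(** Each off-diagonal entry of M_lambda is a real multiple of a single unit.
    This is what makes the three coordinates orthogonal for the invariant
    bilinear forms. *)
Lemma imM_disjoint k (lam : param R k) b c r s : b != c ->
  imM lam b r s * imM lam c r s = 0.
Proof.
have U p q : b != c -> qim (upper_unit R p q) b * qim (upper_unit R p q) c = 0.
  elim/ord3_ind: b; elim/ord3_ind: c; rewrite -val_eqE /= ?inordK // => _;
  by case: p q => [|[|[|p]]] [|[|[|[|q]]]]; rewrite /qim /= ?inordK //= ?(mulr0, mul0r, oppr0).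
move=> bc; rewrite !mxE; case: ltngtP => _.
- by rewrite !qimZ mulrACA U // mulr0.
- by rewrite !qim_conj !qimZ mulrNN mulrACA U // mulr0.
- have one0 d : qim (1 : H) d = 0 by elim/ord3_ind: d; rewrite /qim /= ?inordK.
  by rewrite one0 mul0r.
Qed.

Lemma skew_entry k (X : 'M[R]_k) r s : X^T = - X -> X s r = - X r s.
Proof. by move=> sX; transitivity (X^T r s); [rewrite mxE|rewrite sX mxE]. Qed.

Lemma tr_imM_mul k (lam : param R k) b c :
  \tr (imM lam b *m imM lam c) = - \sum_r \sum_s imM lam b r s * imM lam c r s.
Proof.
rewrite -sumrN; apply: eq_bigr => r _; rewrite mxE -sumrN; apply: eq_bigr => s _.
by rewrite (skew_entry r s (tr_imM lam c)) mulrN.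
Qed.

(** An instance of [orthogonal_rotation] for the form tr(X Y), which orthogonal
    congruences preserve. *)
Lemma linked_square k (lam mu : param R k) a q : linked lam mu a q ->
  forall c b, qrot q c b != 0 ->
  \tr (imM mu b *m imM mu b) = \tr (imM lam c *m imM lam c).
Proof.
move=> [aa q1 e] c b cb; have aa' := mulmx1C aa.
pose K c := a *m imM lam c *m a^T.
have trK i j : \tr (K i *m K j) = \tr (imM lam i *m imM lam j).
  by rewrite /K -!mulmxA mxtrace_mulC -!mulmxA !(mulmxA a^T a) aa' !mul1mx mulmx1.
have off (nu : param R k) c' d : c' != d -> \tr (imM nu c' *m imM nu d) = 0.
  move=> cd; rewrite tr_imM_mul big1 ?oppr0 // => r _; rewrite big1 // => s _.
  exact: imM_disjoint.
rewrite -trK; apply: (@orthogonal_rotation _ _ (fun X Y => \tr (X *m Y)) K (imM mu) q) => //.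
- by move=> Y x X X' /=; rewrite mulmxDl -scalemxAl raddfD /= mxtraceZ.
- by move=> X Y; rewrite mxtrace_mulC.
- by move=> c' d cd; rewrite trK off.
- by move=> c' d cd; rewrite off.
Qed.

(** An instance of [alternating_rotation] for the form tr(X Y Z), which is
    alternating on skew matrices because transposing reverses the product. *)
Lemma linked_triple k (lam mu : param R k) a q : linked lam mu a q ->
  \tr (imM mu ord0 *m imM mu (inord 1) *m imM mu (inord 2)) =
  \tr (imM lam ord0 *m imM lam (inord 1) *m imM lam (inord 2)).
Proof.
move=> [aa q1 e]; have aa' := mulmx1C aa.
pose K c := a *m imM lam c *m a^T.
have sK c : (K c)^T = - K c by rewrite !trmx_mul trmxK tr_imM mulNmx mulmxN mulmxA.
rewrite (@alternating_rotation _ _ (fun X Y Z => \tr (X *m Y *m Z)) K (imM mu) q) //.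
- rewrite /K -!mulmxA mxtrace_mulC -!mulmxA !(mulmxA a^T a) aa' !mul1mx.
  by rewrite mulmx1 !mulmxA.
- by move=> Y Z x X X' /=; rewrite !mulmxDl -!scalemxAl raddfD /= mxtraceZ.
- by move=> X Z x Y Y' /=; rewrite mulmxDr mulmxDl -scalemxAr -scalemxAl raddfD /= mxtraceZ.
- by move=> X Y x Z Z' /=; rewrite mulmxDr -scalemxAr raddfD /= mxtraceZ.
- by move=> c d f; rewrite tr_mul3_cyc.
- by move=> c d f; rewrite tr_mul3_skew.
Qed.

(** The Pfaffian pairs opposite edges of the tetrahedron of indices, and these
    carry the same unit. *)
Lemma pfaff_disjoint (lam : param R 4) b c : b != c ->
  pfaff (imM lam b) (imM lam c) = 0.
Proof.
move=> bc; rewrite /pfaff !imM_lt ?inordK // /qim /=.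
by elim/ord3_ind: b bc; elim/ord3_ind: c; rewrite -val_eqE /= ?inordK //= => _; ring.
Qed.

Lemma linked_pfaff (lam mu : param R 4) a q : linked lam mu a q ->
  forall c b, qrot q c b != 0 ->
  pfaff (imM mu b) (imM mu b) = det4 a * pfaff (imM lam c) (imM lam c).
Proof.
move=> [aa q1 e] c b cb.
pose K c := a *m imM lam c *m a^T.
have pK i j : pfaff (K i) (K j) = det4 a * pfaff (imM lam i) (imM lam j).
  by rewrite pfaff_congruence // tr_imM.
rewrite -pK. apply: (@orthogonal_rotation _ _ (@pfaff R) K (imM mu) q) => //.
- exact: pfaff_linear.
- exact: pfaff_sym.
- by move=> i j ij; rewrite pK pfaff_disjoint ?mulr0.
- by move=> i j ij; rewrite pfaff_disjoint.
Qed.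

Lemma linked_pfaff3 (lam mu : param R 4) a q : linked lam mu a q ->
  pfaff3 (imM mu ord0) (imM mu (inord 1)) (imM mu (inord 2)) =
  det4 a * pfaff3 (imM lam ord0) (imM lam (inord 1)) (imM lam (inord 2)).
Proof.
move=> [aa q1 e].
pose K c := a *m imM lam c *m a^T.
have sK c : (K c)^T = - K c by rewrite !trmx_mul trmxK tr_imM mulNmx mulmxN mulmxA.
rewrite (@alternating_rotation _ _ (@pfaff3 R) K (imM mu) q) //.
- by rewrite pfaff3_congruence // tr_imM.
- exact: pfaff3_linear1.
- exact: pfaff3_linear2.
- exact: pfaff3_linear3.
- by move=> c d f; rewrite pfaff3_cyc.
- by move=> c d f; rewrite pfaff3_anti.
Qed.

End ParameterInvariants.

(** * Parameters are determined by the invariants up to signed permutations *)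

Section Combinatorics.
Variable R : realType.

(** The signs relating the two triples can be chosen with product 1: if they
    have product -1, then the product of the numbers is its own opposite, so one
    of them is zero and its sign is free. *)
Lemma even_signs (a0 a1 a2 b0 b1 b2 : R) :
  a0 ^+ 2 = b0 ^+ 2 -> a1 ^+ 2 = b1 ^+ 2 -> a2 ^+ 2 = b2 ^+ 2 ->
  a0 * a1 * a2 = b0 * b1 * b2 ->
  [\/ [/\ b0 = a0, b1 = a1 & b2 = a2], [/\ b0 = a0, b1 = - a1 & b2 = - a2],
      [/\ b0 = - a0, b1 = a1 & b2 = - a2] | [/\ b0 = - a0, b1 = - a1 & b2 = a2]].
Proof.
have sq (x y : R) : x ^+ 2 = y ^+ 2 -> y = x \/ y = - x.
  by move=> /esym/eqP; rewrite eqf_sqr => /orP[] /eqP; [left|right].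
have odd (x y z : R) : x * y * z = - (x * y * z) -> [\/ x = 0, y = 0 | z = 0].
  move=> e; have /eqP : x * y * z = 0 by lra.
  by rewrite !mulf_eq0 -orbA => /or3P[] /eqP; [constructor 1|constructor 2|constructor 3].
move=> /sq[->|->] /sq[->|->] /sq[->|->]; rewrite ?(mulrN, mulNr, opprK);
  first [by move=> _; constructor 1; split | by move=> _; constructor 2; split
    | by move=> _; constructor 3; split | by move=> _; constructor 4; split
    | move=> /odd[] ->; rewrite oppr0].
all: first [by constructor 1; split | by constructor 2; split
    | by constructor 3; split | by constructor 4; split].
Qed.

Definition symmetric2 k (f : 'I_k -> 'I_k -> R) := forall p q, f p q = f q p.

(** Entries are labelled by the index opposite to them, so that a permutation
    of the indices permutes the labels in the same way. *)
Definition opp3 (f : 'I_3 -> 'I_3 -> R) (i : 'I_3) : R :=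
  [:: f (inord 1) (inord 2); f ord0 (inord 2); f ord0 (inord 1)]`_i.

Lemma opp3E (f : 'I_3 -> 'I_3 -> R) i j k : symmetric2 f ->
  i != j -> i != k -> j != k -> f j k = opp3 f i.
Proof.
move=> sf; elim/ord3_ind: i; elim/ord3_ind: j; elim/ord3_ind: k;
  rewrite /opp3 -!val_eqE /= ?inordK //.
Qed.

Lemma opp3_ext (f g : 'I_3 -> 'I_3 -> R) : symmetric2 f -> symmetric2 g ->
  (forall i, opp3 g i = opp3 f i) -> forall p q, p != q -> g p q = f p q.
Proof.
move=> sf sg fg p q pq.
have [i ip iq] : exists2 i : 'I_3, i != p & i != q.
  elim/ord3_ind: p pq; elim/ord3_ind: q; rewrite -!val_eqE /= ?inordK // => _;
  by [exists ord0; rewrite -val_eqE /= !inordK|exists (inord 1); rewrite -val_eqE /= !inordK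
    |exists (inord 2); rewrite -val_eqE /= !inordK].
by rewrite (opp3E sg ip iq pq) fg (opp3E sf ip iq pq).
Qed.

Lemma opp3_perm (f : 'I_3 -> 'I_3 -> R) (s : 'S_3) i : symmetric2 f ->
  opp3 (fun p q => f (s p) (s q)) i = opp3 f (s i).
Proof.
move=> sf; have d (j k : 'I_3) : i != j -> i != k -> j != k ->
    f (s j) (s k) = opp3 f (s i).
  by move=> ij ik jk; rewrite (opp3E (i := s i) sf) ?(inj_eq perm_inj).
by elim/ord3_ind: i d => d; rewrite [LHS]/opp3 /= ?inordK //= d // -val_eqE /= !inordK.
Qed.

Lemma prod3E (F : 'I_3 -> R) : \prod_c F c = F ord0 * F (inord 1) * F (inord 2).
Proof.
rewrite !big_ord_recr big_ord0 /= mul1r.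
by congr (F _ * F _ * F _); apply/val_inj; rewrite /= ?inordK.
Qed.

(** Flipping the sign of the basis vector of index [i] flips the two entries
    that are not opposite to [i]. *)
Lemma sim3_flip (f g : 'I_3 -> 'I_3 -> R) (i : 'I_3) :
  symmetric2 f -> symmetric2 g ->
  (forall j, opp3 g j = if j == i then opp3 f j else - opp3 f j) -> sim f g.
Proof.
move=> sf sg fg; apply: (sim_trans (sim_sign f (pred1 i))); apply: sim_ext.
apply: opp3_ext => // [p q|j]; first by rewrite [in RHS]sf; ring.
rewrite fg; elim/ord3_ind: i {fg}; elim/ord3_ind: j;
  by rewrite /opp3 /= ?inordK //= -!val_eqE /= ?inordK //=; ring.
Qed.

Lemma sim3 (f g : 'I_3 -> 'I_3 -> R) (s : 'S_3) : symmetric2 f -> symmetric2 g ->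
  (forall i, opp3 g i ^+ 2 = opp3 f (s i) ^+ 2) ->
  \prod_i opp3 g i = \prod_i opp3 f i -> sim f g.
Proof.
move=> sf sg sq pr; apply: (sim_trans (sim_perm f s)).
set h := (fun p q => _); have sh : symmetric2 h by move=> p q; exact: sf.
have hE i : opp3 h i = opp3 f (s i) by exact: opp3_perm.
have prh : \prod_i opp3 h i = \prod_i opp3 g i.
  by rewrite pr [RHS](reindex_perm s); apply: eq_bigr => i _; rewrite hE.
have sqh i : opp3 h i ^+ 2 = opp3 g i ^+ 2 by rewrite hE sq.
rewrite !prod3E in prh.
case: (even_signs (sqh _) (sqh _) (sqh _) prh) => -[e0 e1 e2].
- by apply: sim_ext; apply: opp3_ext => //; elim/ord3_ind.
- apply: (@sim3_flip _ _ ord0) => //; elim/ord3_ind; rewrite -val_eqE /= ?inordK //.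
- apply: (@sim3_flip _ _ (inord 1)) => //; elim/ord3_ind; rewrite -val_eqE /= ?inordK //.
- apply: (@sim3_flip _ _ (inord 2)) => //; elim/ord3_ind; rewrite -val_eqE /= ?inordK //.
Qed.

Lemma sim2 (f g : 'I_2 -> 'I_2 -> R) : symmetric2 f -> symmetric2 g ->
  g ord0 ord_max ^+ 2 = f ord0 ord_max ^+ 2 -> sim f g.
Proof.
move=> sf sg /eqP; rewrite eqf_sqr => /orP[] /eqP e.
  by apply: sim_ext; elim/ord2_ind; elim/ord2_ind => //; rewrite sg sf.
apply: (sim_trans (sim_sign f (pred1 ord0))); apply: sim_ext.
elim/ord2_ind; elim/ord2_ind => //= _; rewrite ?eqxx /=; last rewrite sg sf.
  by rewrite e; ring.
by rewrite e; ring.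
Qed.

(** For four indices, the entry of the pair {0, c + 1} and the one of the
    complementary pair, which carries the same imaginary unit. *)
Definition near4 (f : 'I_4 -> 'I_4 -> R) (c : 'I_3) : R :=
  [:: f ord0 (inord 1); f ord0 (inord 2); f ord0 (inord 3)]`_c.
Definition far4 (f : 'I_4 -> 'I_4 -> R) (c : 'I_3) : R :=
  [:: f (inord 2) (inord 3); f (inord 1) (inord 3); f (inord 1) (inord 2)]`_c.

Lemma pair4_ext (f g : 'I_4 -> 'I_4 -> R) : symmetric2 f -> symmetric2 g ->
  (forall c, near4 g c = near4 f c) -> (forall c, far4 g c = far4 f c) ->
  forall p q, p != q -> g p q = f p q.
Proof.
move=> sf sg n r.
move: (n ord0) (n (inord 1)) (n (inord 2)) (r ord0) (r (inord 1)) (r (inord 2)).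
rewrite /near4 /far4 /= !inordK //= => n0 n1 n2 r0 r1 r2.
by elim/ord4_ind; elim/ord4_ind; rewrite ?eqxx // => _; rewrite sf sg.
Qed.

Lemma lift0_inord (c : 'I_3) : lift ord0 c = inord c.+1 :> 'I_4.
Proof. by apply/val_inj; rewrite /= inordK /bump ?leq0n ?add1n // ltnS. Qed.

Lemma near4E f c : near4 f c = f ord0 (lift ord0 c).
Proof. by rewrite lift0_inord; elim/ord3_ind: c; rewrite /near4 /= ?inordK. Qed.

Lemma far4E f i j k : symmetric2 f -> i != j -> i != k -> j != k ->
  f (lift ord0 j) (lift ord0 k) = far4 f i.
Proof.
move=> sf; rewrite !lift0_inord.
elim/ord3_ind: i; elim/ord3_ind: j; elim/ord3_ind: k;
  by rewrite /far4 -!val_eqE /= ?inordK.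
Qed.

Lemma near4_lift f (s : 'S_3) c : let t := lift_perm ord0 ord0 s in
  near4 (fun p q => f (t p) (t q)) c = near4 f (s c).
Proof. by rewrite /= !near4E lift_perm_id lift_perm_lift. Qed.

Lemma far4_lift f (s : 'S_3) c : symmetric2 f -> let t := lift_perm ord0 ord0 s in
  far4 (fun p q => f (t p) (t q)) c = far4 f (s c).
Proof.
move=> sf t; have [j [k [cj ck jk]]] : exists j k : 'I_3, [/\ c != j, c != k & j != k].
  elim/ord3_ind: c; [exists (inord 1), (inord 2)|exists ord0, (inord 2)|exists ord0, (inord 1)];
  by rewrite -!val_eqE /= !inordK.
rewrite -(far4E _ cj ck jk); last by move=> p q; exact: sf.
by rewrite !lift_perm_lift; apply: far4E; rewrite ?(inj_eq perm_inj).
Qed.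

(** Flipping the signs of the two basis vectors of the pair {0, i + 1} flips
    the four entries that do not belong to the pairs of class [i]. *)
Definition flip4 (f : 'I_4 -> 'I_4 -> R) (i : 'I_3) (p q : 'I_4) : R :=
  (-1) ^+ pred2 ord0 (lift ord0 i) p * (-1) ^+ pred2 ord0 (lift ord0 i) q * f p q.

Lemma near4_flip f i c :
  near4 (flip4 f i) c = if c == i then near4 f c else - near4 f c.
Proof.
rewrite /near4 /flip4 lift0_inord; elim/ord3_ind: i; elim/ord3_ind: c;
by rewrite /= ?inordK //= -!val_eqE /= ?inordK //=; ring.
Qed.

Lemma far4_flip f i c :
  far4 (flip4 f i) c = if c == i then far4 f c else - far4 f c.
Proof.
rewrite /far4 /flip4 lift0_inord; elim/ord3_ind: i; elim/ord3_ind: c;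
by rewrite /= ?inordK //= -!val_eqE /= ?inordK //=; ring.
Qed.

(** The double transposition which preserves the two pairs of class [i]
    exchanges the near and far entries of the two other classes. *)
Lemma sim4_swap (f g : 'I_4 -> 'I_4 -> R) (i : 'I_3) :
  symmetric2 f -> symmetric2 g ->
  (forall c, near4 g c = if c == i then near4 f c else far4 f c) ->
  (forall c, far4 g c = if c == i then far4 f c else near4 f c) -> sim f g.
Proof.
move=> sf sg n r.
have main (p q u w : 'I_4) : uniq [:: p; q; u; w] ->
    let s := (tperm p q * tperm u w)%g in [/\ s p = q, s q = p, s u = w & s w = u].
  rewrite /= !inE !negb_or => /and4P[/and3P[pq pu pw] /andP[qu qw] uw _].
  by split; rewrite permM ?tpermL ?tpermR ?(tpermD pu qu) ?(tpermD pw qw)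
    ?tpermL ?tpermR ?tpermD // eq_sym.
have sh (s : 'S_4) : symmetric2 (fun p q => f (s p) (s q)) by move=> p q; exact: sf.
have fin (s : 'S_4) :
    (forall c, near4 g c = near4 (fun p q => f (s p) (s q)) c) ->
    (forall c, far4 g c = far4 (fun p q => f (s p) (s q)) c) -> sim f g.
  by move=> n' r'; apply: (sim_trans (sim_perm f s)); apply: sim_ext; exact: pair4_ext.
elim/ord3_ind: i n r => n r.
- have [|s0 s1 s2 s3] := main ord0 (inord 1) (inord 2) (inord 3).
    by rewrite /= !inE -!val_eqE /= !inordK.
  by apply: (fin (tperm ord0 (inord 1) * tperm (inord 2) (inord 3))%g) => c; rewrite ?n ?r;
    elim/ord3_ind: c; rewrite /near4 /far4 -val_eqE /= ?inordK //= (s0, s1, s2, s3) ?(s0, s1, s2, s3) // sf.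
- have [|s0 s2 s1 s3] := main ord0 (inord 2) (inord 1) (inord 3).
    by rewrite /= !inE -!val_eqE /= !inordK.
  by apply: (fin (tperm ord0 (inord 2) * tperm (inord 1) (inord 3))%g) => c; rewrite ?n ?r;
    elim/ord3_ind: c; rewrite /near4 /far4 -val_eqE /= ?inordK //= (s0, s1, s2, s3) ?(s0, s1, s2, s3) // sf.
- have [|s0 s3 s1 s2] := main ord0 (inord 3) (inord 1) (inord 2).
    by rewrite /= !inE -!val_eqE /= !inordK.
  by apply: (fin (tperm ord0 (inord 3) * tperm (inord 1) (inord 2))%g) => c; rewrite ?n ?r;
    elim/ord3_ind: c; rewrite /near4 /far4 -val_eqE /= ?inordK //= (s0, s1, s2, s3) ?(s0, s1, s2, s3) // sf.
Qed.

(** Double transpositions adjust the signs of the differences near - far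
    without changing the sums near + far. *)
Lemma sim4_same_sums (f g : 'I_4 -> 'I_4 -> R) : symmetric2 f -> symmetric2 g ->
  (forall c, near4 f c + far4 f c = near4 g c + far4 g c) ->
  (forall c, (near4 f c - far4 f c) ^+ 2 = (near4 g c - far4 g c) ^+ 2) ->
  \prod_c (near4 f c - far4 f c) = \prod_c (near4 g c - far4 g c) -> sim f g.
Proof.
move=> sf sg sum sqm; rewrite !prod3E => prm.
have fin (i : 'I_3) : (forall c, near4 g c - far4 g c =
    if c == i then near4 f c - far4 f c else - (near4 f c - far4 f c)) -> sim f g.
  move=> gm; apply: (@sim4_swap _ _ i) => // c; have := gm c; have := sum c;
  by case: eqP => _; lra.
case: (even_signs (sqm _) (sqm _) (sqm _) prm) => -[e0 e1 e2].
- have dif c : near4 g c - far4 g c = near4 f c - far4 f c by elim/ord3_ind: c.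
  apply: sim_ext; apply: pair4_ext => // c; have := sum c; have := dif c; lra.
- apply: (fin ord0); elim/ord3_ind; rewrite -val_eqE /= ?inordK //.
- apply: (fin (inord 1)); elim/ord3_ind; rewrite -val_eqE /= ?inordK //.
- apply: (fin (inord 2)); elim/ord3_ind; rewrite -val_eqE /= ?inordK //.
Qed.

(** Flips adjust the signs of the sums first; they also change the signs of the
    differences, but evenly many of them. *)
Lemma sim4_same_squares (f g : 'I_4 -> 'I_4 -> R) : symmetric2 f -> symmetric2 g ->
  (forall c, (near4 f c + far4 f c) ^+ 2 = (near4 g c + far4 g c) ^+ 2) ->
  (forall c, (near4 f c - far4 f c) ^+ 2 = (near4 g c - far4 g c) ^+ 2) ->
  \prod_c (near4 f c + far4 f c) = \prod_c (near4 g c + far4 g c) ->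
  \prod_c (near4 f c - far4 f c) = \prod_c (near4 g c - far4 g c) -> sim f g.
Proof.
move=> sf sg sqp sqm prp prm.
have fin (i : 'I_3) : (forall c, near4 g c + far4 g c =
    if c == i then near4 f c + far4 f c else - (near4 f c + far4 f c)) -> sim f g.
  move=> gp; apply: (sim_trans (sim_sign f (pred2 ord0 (lift ord0 i)))).
  rewrite -[X in sim X]/(flip4 f i); apply: sim4_same_sums => //.
  - by move=> p q; rewrite /flip4 [in RHS]sf; ring.
  - by move=> c; rewrite gp near4_flip far4_flip; case: eqP => _; ring.
  - by move=> c; rewrite -sqm near4_flip far4_flip; case: eqP => _; ring.
  - rewrite -prm !prod3E !near4_flip !far4_flip.
    by elim/ord3_ind: i {gp}; rewrite -!val_eqE /= !inordK //=; ring.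
rewrite !prod3E in prp.
case: (even_signs (sqp _) (sqp _) (sqp _) prp) => -[e0 e1 e2].
- by apply: sim4_same_sums => //; elim/ord3_ind.
- apply: (fin ord0); elim/ord3_ind; rewrite -val_eqE /= ?inordK //.
- apply: (fin (inord 1)); elim/ord3_ind; rewrite -val_eqE /= ?inordK //.
- apply: (fin (inord 2)); elim/ord3_ind; rewrite -val_eqE /= ?inordK //.
Qed.

(** Permuting the indices 1, 2, 3 permutes the near and the far entries in the
    same way. *)
Lemma sim4_oriented (f g : 'I_4 -> 'I_4 -> R) (s : 'S_3) :
  symmetric2 f -> symmetric2 g ->
  (forall c, (near4 g c + far4 g c) ^+ 2 = (near4 f (s c) + far4 f (s c)) ^+ 2) ->
  (forall c, (near4 g c - far4 g c) ^+ 2 = (near4 f (s c) - far4 f (s c)) ^+ 2) ->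
  \prod_c (near4 g c + far4 g c) = \prod_c (near4 f c + far4 f c) ->
  \prod_c (near4 g c - far4 g c) = \prod_c (near4 f c - far4 f c) -> sim f g.
Proof.
move=> sf sg sqp sqm prp prm.
pose t := lift_perm ord0 ord0 s; apply: (sim_trans (sim_perm f t)).
set h := (fun p q => _); have sh : symmetric2 h by move=> p q; exact: sf.
have nE c : near4 h c = near4 f (s c) by exact: near4_lift.
have rE c : far4 h c = far4 f (s c) by exact: far4_lift.
apply: sim4_same_squares => // [c|c||].
- by rewrite nE rE sqp.
- by rewrite nE rE sqm.
- by rewrite prp [RHS](reindex_perm s); apply: eq_bigr => c _; rewrite nE rE.
- by rewrite prm [RHS](reindex_perm s); apply: eq_bigr => c _; rewrite nE rE.
Qed.

(** Up to sign, the values of tr(X Y Z) and of [pfaff3] on the coordinates of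
    M_lambda. The products of the near + far and of the near - far are
    stars + triangles and stars - triangles. *)
Definition triangles (f : 'I_4 -> 'I_4 -> R) : R :=
  let n := near4 f in let r := far4 f in
  let o1 := inord 1 in let o2 := inord 2 in
  r ord0 * r o1 * r o2 + r ord0 * n o1 * n o2 + n ord0 * r o1 * n o2 + n ord0 * n o1 * r o2.
Definition stars (f : 'I_4 -> 'I_4 -> R) : R :=
  let n := near4 f in let r := far4 f in
  let o1 := inord 1 in let o2 := inord 2 in
  n ord0 * n o1 * n o2 + n ord0 * r o1 * r o2 + r ord0 * n o1 * r o2 + r ord0 * r o1 * n o2.

(** The sign [d] is an orientation; when it is negative, it is absorbed by
    flipping one basis vector, which negates the near entries only. *)
Lemma sim4 (f g : 'I_4 -> 'I_4 -> R) (s : 'S_3) (d : R) :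
  symmetric2 f -> symmetric2 g -> d ^+ 2 = 1 ->
  (forall c, near4 g c ^+ 2 + far4 g c ^+ 2 = near4 f (s c) ^+ 2 + far4 f (s c) ^+ 2) ->
  (forall c, near4 g c * far4 g c = d * (near4 f (s c) * far4 f (s c))) ->
  triangles g = triangles f -> stars g = d * stars f -> sim f g.
Proof.
move=> sf sg /eqP; rewrite sqrf_eq1 => /orP[] /eqP -> sq pr tr st.
  apply: (sim4_oriented (s := s)) => // [c|c||].
  - by have := sq c; have := pr c; lra.
  - by have := sq c; have := pr c; lra.
  - by rewrite !prod3E; move: tr st; rewrite /triangles /stars; lra.
  - by rewrite !prod3E; move: tr st; rewrite /triangles /stars; lra.
apply: (sim_trans (sim_sign f (pred1 ord0))).
set h := (fun p q => _).
have nE c : near4 h c = - near4 f c.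
  by elim/ord3_ind: c; rewrite /near4 /h /= ?inordK //= -!val_eqE /= ?inordK //=; ring.
have rE c : far4 h c = far4 f c.
  by elim/ord3_ind: c; rewrite /far4 /h /= ?inordK //= -!val_eqE /= ?inordK //=; ring.
apply: (sim4_oriented (s := s)) => // [p q|c|c||].
- by rewrite /h [in RHS]sf; ring.
- by rewrite !nE !rE; have := sq c; have := pr c; lra.
- by rewrite !nE !rE; have := sq c; have := pr c; lra.
- by rewrite !prod3E !nE !rE; move: tr st; rewrite /triangles /stars; lra.
- by rewrite !prod3E !nE !rE; move: tr st; rewrite /triangles /stars; lra.
Qed.

End Combinatorics.

(** * Uniqueness of the class of an orbit *)

Section Uniqueness.
Variable R : realType.
Local Notation H := (quat R).

Lemma linked_transversal k (lam mu : param R k) a q : linked lam mu a q ->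
  exists s : 'S_3, forall b, qrot q (s b) b != 0.
Proof. by case=> _ q1 _; exact: qrot_transversal. Qed.

Lemma symmetric2_coef k (lam : param R k) : symmetric2 (coef lam).
Proof. exact: coef_sym. Qed.

Lemma imM_diag k (lam : param R k) b p : imM lam b p p = 0.
Proof. by rewrite mxE mxE ltnn; elim/ord3_ind: b; rewrite /qim /= ?inordK. Qed.

(** A product of equations, used as a single rewrite rule. *)
Lemma imM_skew4 (lam : param R 4) b : let X := imM lam b in
  (X (inord 1) ord0 = - X ord0 (inord 1)) * (X (inord 2) ord0 = - X ord0 (inord 2)) *
  (X (inord 3) ord0 = - X ord0 (inord 3)) *
  (X (inord 2) (inord 1) = - X (inord 1) (inord 2)) *
  (X (inord 3) (inord 1) = - X (inord 1) (inord 3)) *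
  (X (inord 3) (inord 2) = - X (inord 2) (inord 3)).
Proof. by have [_ [? ? ? ? [? ?]]] := skew4 (tr_imM lam b); do !split. Qed.

Lemma mulmx4E m n (A : 'M[R]_(m, 4)) (B : 'M[R]_(4, n)) i j :
  (A *m B) i j = A i ord0 * B ord0 j + A i (inord 1) * B (inord 1) j +
                 A i (inord 2) * B (inord 2) j + A i (inord 3) * B (inord 3) j.
Proof. by rewrite mxE sum4E. Qed.

(** Up to constants, the form tr(X Y) gives near^2 + far^2, the
    Pfaffian gives near * far up to the orientation det a, and the two trilinear
    forms give the triangles and, up to the same orientation, the stars. *)
Lemma linked_sim4 (lam mu : param R 4) a q :
  linked lam mu a q -> sim (coef lam) (coef mu).
Proof.
move=> lm; have [s hs] := linked_transversal lm.
have [aa _ _] := lm.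
have trE (nu : param R 4) b : \tr (imM nu b *m imM nu b) =
    - 2 * (near4 (coef nu) b ^+ 2 + far4 (coef nu) b ^+ 2).
  rewrite tr_imM_mul !sum4E !(imM_skew4, imM_diag) !imM_lt ?inordK //.
  by elim/ord3_ind: b; rewrite /near4 /far4 /qim /= ?inordK //=; ring.
have pfE (nu : param R 4) b : pfaff (imM nu b) (imM nu b) =
    - 2 * (near4 (coef nu) b * far4 (coef nu) b).
  rewrite /pfaff !imM_lt ?inordK //.
  by elim/ord3_ind: b; rewrite /near4 /far4 /qim /= ?inordK //=; ring.
apply: (sim4 (s := s) (d := det4 a)); try exact: symmetric2_coef.
- exact: det4_orthogonal.
- by move=> c; have := linked_square lm (hs c); rewrite !trE; lra.
- by move=> c; have := linked_pfaff lm (hs c); rewrite !pfE; lra.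
- have cubE (nu : param R 4) : \tr (imM nu ord0 *m imM nu (inord 1) *m imM nu (inord 2)) =
      - triangles (coef nu).
    rewrite /mxtrace sum4E !mulmx4E !(imM_skew4, imM_diag) !imM_lt ?inordK //.
    by rewrite /triangles /near4 /far4 /qim /= ?inordK //=; ring.
  by have := linked_triple lm; rewrite !cubE; lra.
- have cubE (nu : param R 4) : pfaff3 (imM nu ord0) (imM nu (inord 1)) (imM nu (inord 2)) =
      - stars (coef nu).
    have comE (A B : 'M[R]_4) i j : (A *m B - B *m A) i j = (A *m B) i j - (B *m A) i j.
      by rewrite !mxE.
    rewrite /pfaff3 /pfaff !comE !mulmx4E !(imM_skew4, imM_diag) !imM_lt ?inordK //.
    by rewrite /stars /near4 /far4 /qim /= ?inordK //=; ring.
  by have := linked_pfaff3 lm; rewrite !cubE; lra.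
Qed.

Lemma rev_ord3 : (rev_ord ord0 = inord 2 :> 'I_3) *
  (rev_ord (inord 1) = inord 1 :> 'I_3) * (rev_ord (inord 2) = ord0 :> 'I_3).
Proof. by do !split; apply/val_inj; rewrite /= !inordK. Qed.

Lemma linked_sim3 (lam mu : param R 3) a q :
  linked lam mu a q -> sim (coef lam) (coef mu).
Proof.
move=> lm; have [s hs] := linked_transversal lm.
have skE (nu : param R 3) b p r : imM nu b p r = - imM nu b r p.
  by apply: skew_entry; exact: tr_imM.
have sk10 nu b := skE nu b (inord 1) ord0.
have sk20 nu b := skE nu b (inord 2) ord0.
have sk21 nu b := skE nu b (inord 2) (inord 1).
(* the unit of index b lies on the pair opposite to rev_ord b *)
pose t : 'S_3 := (perm rev_ord_inj * s * perm rev_ord_inj)%g.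
have tE i : t i = rev_ord (s (rev_ord i)) by rewrite !permM !permE.
have trE (nu : param R 3) b : \tr (imM nu b *m imM nu b) =
    - 2 * opp3 (coef nu) (rev_ord b) ^+ 2.
  rewrite tr_imM_mul !sum3E !(sk10, sk20, sk21, imM_diag) !imM_lt ?inordK //.
  by elim/ord3_ind: b; rewrite rev_ord3 /opp3 /qim /= ?inordK //=; ring.
apply: (sim3 (s := t)); try exact: symmetric2_coef.
- move=> i; have := linked_square lm (hs (rev_ord i)); rewrite !trE rev_ordK tE.
  by lra.
- have cubE (nu : param R 3) : \tr (imM nu ord0 *m imM nu (inord 1) *m imM nu (inord 2)) =
      - \prod_i opp3 (coef nu) i.
    rewrite /mxtrace sum3E !mulmx3E !(sk10, sk20, sk21, imM_diag) !imM_lt ?inordK //.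
    by rewrite prod3E /opp3 /qim /= ?inordK //=; ring.
  by have := linked_triple lm; rewrite !cubE; lra.
Qed.

(** Only the unit i occurs, but it may be matched with j or k when the parameter
    vanishes; summing over the three units avoids the distinction. *)
Lemma linked_sim2 (lam mu : param R 2) a q :
  linked lam mu a q -> sim (coef lam) (coef mu).
Proof.
move=> lm; have [s hs] := linked_transversal lm.
have sk (nu : param R 2) b : imM nu b ord_max ord0 = - imM nu b ord0 ord_max.
  by apply: skew_entry; exact: tr_imM.
have sum2 (F : 'I_2 -> R) : \sum_j F j = F ord0 + F ord_max.
  by rewrite !big_ord_recr big_ord0 /= add0r; congr (F _ + F _); apply/val_inj.
have trE (nu : param R 2) b : \tr (imM nu b *m imM nu b) =
    - 2 * (if b == ord0 then coef nu ord0 ord_max ^+ 2 else 0).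
  rewrite tr_imM_mul !sum2 sk !imM_diag imM_lt //.
  by elim/ord3_ind: b; rewrite -val_eqE /qim /= ?inordK //=; ring.
apply: sim2; try exact: symmetric2_coef.
have sumE (nu : param R 2) : \sum_b \tr (imM nu b *m imM nu b) =
    - 2 * coef nu ord0 ord_max ^+ 2.
  by rewrite sum3E !trE -!val_eqE /= !inordK //=; ring.
have : \sum_b \tr (imM mu b *m imM mu b) = \sum_b \tr (imM lam b *m imM lam b).
  rewrite [RHS](reindex_perm s); apply: eq_bigr => b _.
  by rewrite (linked_square lm (hs b)).
by rewrite !sumE; lra.
Qed.

Lemma frames_adm_rel k (lam mu : adm R k) (v w : 'I_k -> quat2 R) :
  k \in [:: 2; 3; 4]%N ->
  (forall i j, hprod (v i) (v j) = Mmx (val lam) i j) ->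
  (forall i j, hprod (w i) (w j) = Mmx (val mu) i j) ->
  reach (fspan v) (fspan w) -> adm_rel lam mu.
Proof.
move=> hk hv hw /(frames_linked hv hw)[a [q lm]]; apply: sim_adm_rel.
move: hk; rewrite !inE => /or3P[] /eqP kE; subst k.
- exact: linked_sim2 lm.
- exact: linked_sim3 lm.
- exact: linked_sim4 lm.
Qed.

End Uniqueness.

(** * Orbits and their classes *)

Section Orbits.
Variable R : realType.

Lemma normalizable_plane k (U : {vspace quat2 R}) : k \in [:: 2; 3; 4]%N ->
  \dim U = k -> normalizable k U.
Proof.
move=> hk dU; have [v ov UE] := exists_orthonormal_basis dU.
subst U; move: hk; rewrite !inE => /or3P[] /eqP kE; subst k.
- exact: normalizable2.
- exact: normalizable3.
- exact: normalizable4.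
Qed.

Lemma orbit_reach k (P Q : Gr R k) : orbit_of P Q <-> reach (val P) (val Q).
Proof. by []. Qed.

Lemma orbit_reach2 k (O : set (Gr R k)) (P Q : Gr R k) :
  is_orbit O -> O P -> O Q -> reach (val P) (val Q).
Proof.
move=> [P0 ->] /orbit_reach P0P /orbit_reach P0Q.
exact: reach_trans (reach_sym P0P) P0Q.
Qed.

Lemma fspan_basis k (U : {vspace quat2 R}) (v : 'I_k -> quat2 R) :
  \dim U = k -> U = fspan v -> basis_of U [tuple v p | p < k].
Proof.
by move=> dU UE; rewrite basisEdim size_tuple dU leqnn andbT UE subvv.
Qed.

Lemma basis_fspan k (U : {vspace quat2 R}) (v : k.-tuple (quat2 R)) :
  basis_of U v -> U = fspan (tnth v).
Proof.
move=> /span_basis <-; rewrite /fspan; congr (<< _ >>)%VS.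
by rewrite -[LHS](map_tnth_enum v).
Qed.

End Orbits.

Theorem corollary1p1 (R : realType) (k : nat) (hk : k \in [:: 2; 3; 4]%N)
    (O : set (Gr R k)) (hO : is_orbit O) :
  (exists2 theta : 'I_k -> R, (forall p, 0 <= theta p <= 2 * pi) &
     exists2 P : Gr R k, O P & val P = theta_span theta) /\
  (forall theta : 'I_k -> R, (forall p, 0 <= theta p <= 2 * pi) ->
     (exists2 P : Gr R k, O P & val P = theta_span theta) ->
     exists2 lam : adm R k,
       (forall p q : 'I_k, (p < q)%N ->
          coef (val lam) p q = cos (theta p - theta q)) &
       forall x : X R k, corresponds x O <-> x = class_of lam).
Proof.
split.
  have [P0 OE] := hO.
  have [theta th P0th] := normalizable_plane hk (eqP (valP P0)).
  have dth : \dim (theta_span theta) == k.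
    by rewrite (dim_reach P0th) (eqP (valP P0)).
  exists theta => //; exists (exist _ (theta_span theta) dth) => //.
  by rewrite OE; apply/orbit_reach.
move=> theta _ [P OP Pth].
have k4 : (k <= 4)%N by move: hk; rewrite !inE => /or3P[] /eqP ->.
have am : admissible (cos_param theta).
  case: k hk O hO theta P OP Pth k4 => [|k'] // _ _ _ theta _ _ _ k4.
  exact: admissible_cos_param.
pose lam : adm R k := exist _ (cos_param theta) (asboolT am).
exists lam => [p q pq|x]; first exact: coef_cos_param.
have gram i j : hprod (theta_vec theta i) (theta_vec theta j) = Mmx (val lam) i j.
  by rewrite Mmx_cos_param.
split=> [[mu -> [Q OQ [v vQ vM]]]|->].
  (* two frames of planes of the same orbit have equivalent parameters *)
  apply/esym/eqmodP; apply: (frames_adm_rel hk gram vM).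
  rewrite -(basis_fspan vQ) -[fspan _]/(theta_span theta) -Pth.
  exact: orbit_reach2 hO OP OQ.
exists lam => //; exists P => //; exists [tuple theta_vec theta p | p < k].
  by apply: fspan_basis => //; rewrite (eqP (valP P)).
by move=> i j; rewrite !tnth_mktuple.
Qed.
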